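(* Let $\mathbf b=(b_1,b_2)\in\mathbb N^2$ with $\gcd(b_1,b_2)=1$, let $0<\alpha<1$, and let $\mathcal W=\{(u_j,v_j):1\le j\le J\}\subset\mathbb Z^2$ be a set of $J$ distinct lattice points satisfying condition $( * )$ and with $J<2^{b_1+b_2}$. Let $(P_i)_{i\ge0}$ be an $\alpha$-random walk, let $X_i=1$ if $P_i$ is $\mathbf b$-visible from every point of $\mathcal W$ and $X_i=0$ otherwise, and let $\overline S(n)=\frac1n\sum_{i=1}^n X_i$. Then almost surely $$\lim_{n\to\infty}\overline S(n)=\prod_{p}\Big(1-\frac{J}{p^{b_1+b_2}}\Big),$$ where $p$ runs over all primes.
   Context: $\mathbf b$-visibility: given two distinct lattice points $P=(p_1,p_2)$, $Q=(q_1,q_2)\in\mathbb Z^2$, they determine a curve through both of the form $a_1(y-q_2)^{b_1}=a_2(x-q_1)^{b_2}$ for some $(a_1,a_2)\in\mathbb Q^2\setminus\{(0,0)\}$; $P$ is called $\mathbf b$-visible from $Q$ if no other lattice point lies on the segment of this curve between $P$ and $Q$. (This relation is symmetric.) Condition $( * )$ on a finite set $\mathcal W\subset\mathbb Z^2$: distinct points of $\mathcal W$ are pairwise $\mathbf b$-visible from each other. An $\alpha$-random walk ($0<\alpha<1$) starting at the origin is defined by $P_0=(0,0)$ and $P_{i+1}=P_i+(1,0)$ with probability $\alpha$, $P_{i+1}=P_i+(0,1)$ with probability $1-\alpha$, the steps being independent. *)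

(* Defs.v *)
From HB Require Import structures.
From mathcomp Require Import all_boot all_order all_algebra.
From mathcomp Require Import all_classical all_reals all_analysis.
Set Implicit Arguments. Unset Strict Implicit. Unset Printing Implicit Defensive.
Import Order.TTheory GRing.Theory Num.Theory numFieldNormedType.Exports.
Local Open Scope ring_scope.
Local Open Scope classical_set_scope.

Definition pt := (int * int)%type.

Definition on_curve (b1 b2 : nat) (a1 a2 : rat) (Q R : pt) : Prop :=
  a1 * ((R.2 - Q.2)%:~R) ^+ b1 = a2 * ((R.1 - Q.1)%:~R) ^+ b2.

Definition between (x y z : int) : bool :=
  (Num.min x y <= z) && (z <= Num.max x y).

(* P is b-visible from Q: P and Q are distinct and, for the curve
   a1 (y-q2)^b1 = a2 (x-q1)^b2 through P and Q ((a1,a2) <> (0,0), unique up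
   to scaling), no lattice point other than P, Q lies on the arc of that
   curve between P and Q (the part of the curve inside the box spanned by
   P and Q, which is exactly the monotone arc joining them). *)
Definition bvisible (b1 b2 : nat) (P Q : pt) : Prop :=
  P <> Q /\
  forall a1 a2 : rat, (a1, a2) <> (0, 0) ->
    on_curve b1 b2 a1 a2 Q Q -> on_curve b1 b2 a1 a2 Q P ->
    forall R : pt, R <> P -> R <> Q ->
      between P.1 Q.1 R.1 -> between P.2 Q.2 R.2 ->
      ~ on_curve b1 b2 a1 a2 Q R.

Definition condition_star (b1 b2 : nat) (W : seq pt) : Prop :=
  forall u v, u \in W -> v \in W -> u <> v -> bvisible b1 b2 u v.

Definition mutually_independent d (T : measurableType d) (R : realType)
  (P : probability T R) (E : nat -> set T) : Prop :=
  forall s : seq nat, uniq s ->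
    P (\bigcap_(i in [set` s]) E i) = (\prod_(i <- s) P (E i))%E.

(* The walk driven by the events E i: step i+1 is (1,0) on E i, (0,1) off it.
   walk_pos E n w = P_n(w). *)
Definition walk_pos d (T : measurableType d) (E : nat -> set T) (n : nat) (w : T) : pt :=
  let k := (\sum_(i < n) (`[< E i w >] : nat))%N in
  ((k : int), ((n - k)%N : int)).

Definition Xvis d (T : measurableType d) (b1 b2 : nat) (W : seq pt)
  (E : nat -> set T) (i : nat) (w : T) : bool :=
  `[< forall u, u \in W -> bvisible b1 b2 (walk_pos E i w) u >].

Definition Sbar d (T : measurableType d) (R : realType) (b1 b2 : nat) (W : seq pt)
  (E : nat -> set T) (n : nat) (w : T) : R :=
  (n%:R)^-1 * \sum_(1 <= i < n.+1) ((Xvis b1 b2 W E i w : nat)%:R : R).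

Definition prime_partial_prod (R : realType) (J b : nat) (N : nat) : R :=
  \prod_(p < N | prime p) (1 - J%:R / (p%:R ^+ b)).

(* Main.v *)
(** Condition on the first [i] steps: the law of the walk [m] steps later is the [m]-th iterate
of the averaging operator [T g (x, y) = al g (x+1, y) + (1-al) g (x, y+1)].

Stein's identity for [T] bounds the [T^m]-average of a discrete gradient of a bounded function by
[O(1/sqrt m)], since it rewrites it as a covariance with the horizontal displacement. Indicators
of two residue classes modulo [q] differ by such a gradient, so the horizontal coordinate is
equidistributed modulo [q] up to [O(1/sqrt m)], uniformly in the starting point and in [q].

A point off the horizontal and vertical lines through [W] is visible from [u] iff no prime [p]
satisfies [p^b1 | x-u.1] and [p^b2 | y-u.2]. Primes below a cutoff [M] give a periodic condition
whose mean is the partial Euler product (Chinese remainders, condition (star)). For a prime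
[p >= M], [p] must also divide [x+y-(u.1+u.2)], which is known from the time, so equidistribution
of [x] modulo [p] bounds the contribution of these primes over a block of length [h] by
[O(h/M) + o(h)]. Hence the expected number of visible points in a block of length [h = k^4],
given the past up to a time at most [k^8], is [h (L + o(1))] uniformly.

The block counts minus their conditional expectations form a martingale, so Chebyshev's
inequality with [k^4] blocks and Borel-Cantelli give convergence along the times [k^8]; since
[(k+1)^8 / k^8] tends to 1, the whole sequence of averages converges. *)
Require Import Defs.
From HB Require Import structures.
From mathcomp Require Import all_boot all_order all_algebra.
From mathcomp Require Import all_classical all_reals all_analysis.
From mathcomp Require Import zify ring lra.
Set Implicit Arguments. Unset Strict Implicit. Unset Printing Implicit Defensive.
Import Order.TTheory GRing.Theory Num.Theory numFieldNormedType.Exports.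
Local Open Scope ring_scope.
Local Open Scope classical_set_scope.

(** * The averaging operator of the walk *)

Section Operator.
Variable R : realType.
Variable al : R.
Hypothesis al01 : 0 < al < 1.

Definition walk_op (g : pt -> R) : pt -> R :=
  fun x => al * g (x.1 + 1, x.2) + (1 - al) * g (x.1, x.2 + 1).

(** The gradient between the two possible outcomes of one step, which lie on the same
    antidiagonal. *)
Definition diag_diff (g : pt -> R) : pt -> R :=
  fun x => g (x.1 + 1, x.2) - g (x.1, x.2 + 1).

Local Notation T := walk_op.

Lemma iter_walk_opS m g x : iter m.+1 T g x =
  al * iter m T g (x.1 + 1, x.2) + (1 - al) * iter m T g (x.1, x.2 + 1).
Proof. by []. Qed.

(** After [m] steps the walk is on a known antidiagonal, so a comparison there is enough. This is
    what lets later arguments treat [y.1 + y.2] as a constant. *)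
Lemma le_iter_walk_op_on m (f g : pt -> R) x :
  (forall y, y.1 + y.2 = x.1 + x.2 + m%:Z -> f y <= g y) ->
  iter m T f x <= iter m T g x.
Proof.
move: al01 => /andP[a0 a1]; elim: m x => [|m IH] x H.
  by apply: H; rewrite addr0.
have b0 : 0 <= 1 - al by lra.
rewrite !iter_walk_opS lerD //; [apply: (ler_wpM2l (ltW a0))|apply: (ler_wpM2l b0)];
  apply: IH => y /= yE; apply: H; rewrite yE intS; ring.
Qed.

Lemma eq_iter_walk_op_on m (f g : pt -> R) x :
  (forall y, y.1 + y.2 = x.1 + x.2 + m%:Z -> f y = g y) ->
  iter m T f x = iter m T g x.
Proof.
move=> H; apply/eqP; rewrite eq_le; apply/andP; split;
  by apply: le_iter_walk_op_on => y /H ->.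
Qed.

Lemma iter_walk_opD m f g x :
  iter m T (fun y => f y + g y) x = iter m T f x + iter m T g x.
Proof.
by elim: m x => // m IH x; rewrite !iter_walk_opS !IH; ring.
Qed.

Lemma iter_walk_opZ m k f x :
  iter m T (fun y => k * f y) x = k * iter m T f x.
Proof.
by elim: m x => // m IH x; rewrite !iter_walk_opS !IH; ring.
Qed.

Lemma iter_walk_opB m f g x :
  iter m T (fun y => f y - g y) x = iter m T f x - iter m T g x.
Proof.
by elim: m x => // m IH x; rewrite !iter_walk_opS !IH; ring.
Qed.

Lemma iter_walk_op_cst m k x : iter m T (fun=> k) x = k.
Proof. by elim: m x => // m IH x; rewrite iter_walk_opS !IH; ring. Qed.

Lemma iter_walk_op_sum (I : Type) (r : seq I) (Q : pred I) m (F : I -> pt -> R) x :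
  iter m T (fun y => \sum_(i <- r | Q i) F i y) x = \sum_(i <- r | Q i) iter m T (F i) x.
Proof.
elim: r => [|i r IH].
  under eq_iter_walk_op_on => y _ do rewrite big_nil.
  by rewrite big_nil iter_walk_op_cst.
under eq_iter_walk_op_on => y _ do rewrite big_cons.
rewrite big_cons; case: (Q i) => //.
by rewrite iter_walk_opD IH.
Qed.

Lemma norm_iter_walk_op m g x : `|iter m T g x| <= iter m T (fun y => `|g y|) x.
Proof.
rewrite ler_norml; apply/andP; split.
  rewrite -mulN1r -iter_walk_opZ; apply: le_iter_walk_op_on => y _.
  by rewrite mulN1r lerNl -normrN ler_norm.
by apply: le_iter_walk_op_on => y _; rewrite ler_norm.
Qed.

Lemma walk_op_ge0 m g x : (forall y, 0 <= g y) -> 0 <= iter m T g x.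
Proof.
by move=> g0; rewrite -(iter_walk_op_cst m 0 x); apply: le_iter_walk_op_on => y _.
Qed.

Lemma walk_op_le1 m g x : (forall y, g y <= 1) -> iter m T g x <= 1.
Proof.
by move=> g1; rewrite -(iter_walk_op_cst m 1 x); apply: le_iter_walk_op_on => y _.
Qed.

Lemma iter_walk_op_diag_diff m g x :
  iter m T (diag_diff g) x = diag_diff (iter m T g) x.
Proof.
elim: m x => // m IH x; rewrite iter_walk_opS !IH /diag_diff !iter_walk_opS /=; ring.
Qed.

(** Stein's identity for the binomial law: each of the [m.+1] independent steps has covariance with
    [g] equal to [al * (1 - al)] times the mean gradient over the other [m] steps. *)
Lemma walk_op_stein m g x :
  iter m.+1 T (fun y => y.1%:~R * g y) x =
  (x.1%:~R + m.+1%:R * al) * iter m.+1 T g x +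
  m.+1%:R * (al * (1 - al)) * iter m T (diag_diff g) x.
Proof.
elim: m x => [|m IH] x.
  by rewrite /= /walk_op /diag_diff /= rmorphD /=; ring.
rewrite iter_walk_opS !IH !iter_walk_op_diag_diff.
rewrite ![iter m.+2 _ _ _]iter_walk_opS /diag_diff !(iter_walk_opS m) /=.
rewrite rmorphD /= -(natr1 m.+1) addrAC; ring.
Qed.

Lemma walk_op_mean m x : iter m T (fun y => y.1%:~R) x = x.1%:~R + m%:R * al.
Proof.
elim: m x => [|m IH] x; first by rewrite /= mul0r addr0.
by rewrite iter_walk_opS !IH /= rmorphD /= -(natr1 m); ring.
Qed.

Lemma walk_op_variance m x :
  iter m.+1 T (fun y => (y.1%:~R - (x.1%:~R + m.+1%:R * al)) ^+ 2) x =
  m.+1%:R * (al * (1 - al)).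
Proof.
set c := (x.1%:~R + _).
(* Stein's identity is applied to the centred coordinate, whose gradient is the constant 1. *)
rewrite (@eq_iter_walk_op_on _ _ (fun y => y.1%:~R * (y.1%:~R - c) - c * (y.1%:~R - c))).
  rewrite iter_walk_opB walk_op_stein iter_walk_opZ iter_walk_opB walk_op_mean.
  rewrite iter_walk_op_cst -/c subrr !mulr0 add0r subr0.
  rewrite (@eq_iter_walk_op_on _ _ (fun=> 1)) ?iter_walk_op_cst ?mulr1 // => y _.
  by rewrite /diag_diff /= rmorphD /=; ring.
by move=> y _; ring.
Qed.

Lemma step_variance_gt0 : 0 < al * (1 - al).
Proof. by case/andP: al01 => a0 a1; rewrite mulr_gt0 // subr_gt0. Qed.

Definition smooth_cst : R := (Num.sqrt (al * (1 - al)))^-1.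

Lemma smooth_cst_gt0 : 0 < smooth_cst.
Proof. by rewrite invr_gt0 sqrtr_gt0 step_variance_gt0. Qed.

(** Stein's identity turns the gradient average into [V^-1] times a covariance with the horizontal
    displacement. For bounded [g] that covariance is at most the standard deviation [Num.sqrt V]. *)
Lemma walk_op_smooth m g x : (forall y, `|g y| <= 1) ->
  `|iter m T (diag_diff g) x| <= smooth_cst / Num.sqrt m.+1%:R.
Proof.
move=> g1; have v0 := step_variance_gt0.
set mu : R := x.1%:~R + m.+1%:R * al.
have m0 : 0 < m.+1%:R :> R by rewrite ltr0n.
set V := m.+1%:R * (al * (1 - al)); have V0 : 0 < V by rewrite mulr_gt0.
have E : iter m T (diag_diff g) x = V^-1 * iter m.+1 T (fun y => (y.1%:~R - mu) * g y) x.
  apply: (canRL (mulKf (lt0r_neq0 V0))).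
  rewrite [RHS](@eq_iter_walk_op_on _ _ (fun y => y.1%:~R * g y - mu * g y)); last first.
    by move=> y _; rewrite mulrBl.
  by rewrite [RHS]iter_walk_opB walk_op_stein iter_walk_opZ -/V -/mu addrAC subrr add0r.
set s := Num.sqrt V; have s0 : 0 < s by rewrite sqrtr_gt0.
have ss : s ^+ 2 = V by rewrite sqr_sqrtr // ltW.
have H : `|iter m.+1 T (fun y => (y.1%:~R - mu) * g y) x| <= s.
  apply: (le_trans (norm_iter_walk_op _ _ _)).
  (* The pointwise bound [|z| <= (z^2 + s^2) / (2 s)] replaces Cauchy-Schwarz; its mean is exactly
     [s] because the variance is [V = s^2]. *)
  apply: (@le_trans _ _ (iter m.+1 T (fun y => (2 * s)^-1 * ((y.1%:~R - mu) ^+ 2 + V)) x)).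
    apply: le_iter_walk_op_on => y _; rewrite normrM.
    apply: (@le_trans _ _ `|y.1%:~R - mu|); first by rewrite ler_piMr.
    rewrite mulrC ler_pdivlMr ?mulr_gt0 // -ss -[X in X ^+ 2 + _]/(_) -(real_normK (num_real (y.1%:~R - mu))).
    have := sqr_ge0 (`|y.1%:~R - mu| - s); lra.
  rewrite iter_walk_opZ iter_walk_opD walk_op_variance iter_walk_op_cst -/V -ss.
  by rewrite le_eqVlt; apply/orP; left; apply/eqP; field; rewrite gt_eqF.
rewrite E normrM (@ger0_norm _ V^-1); last by rewrite invr_ge0 ltW.
apply: (@le_trans _ _ (V^-1 * s)); first by rewrite ler_pM2l ?invr_gt0.
rewrite -ss expr2 invfM -mulrA mulVf ?gt_eqF // mulr1 /s /V sqrtrM ?ler0n //.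
by rewrite invfM mulrC.
Qed.
End Operator.

(** * Equidistribution modulo [q] *)

Section PeriodicSums.
Variable R : realType.

(** A partition of unity: multiplying by this sum splits any quantity according to residue classes
    modulo [q]. *)
Lemma sum_dvdz_window (q : nat) (z : int) : (0 < q)%N ->
  \sum_(i < q) ((q%:Z %| z - i%:Z)%Z)%:R = 1 :> R.
Proof.
move=> q0; have qz : (q%:Z != 0) by lia.
have r0 := modz_ge0 z qz; have rq : (z %% q < q%:Z)%Z by apply: ltz_pmod.
have rlt : (`|(z %% q)%Z| < q)%N by lia.
rewrite (bigD1 (Ordinal rlt)) //= big1 ?addr0.
  by rewrite -eqz_mod_dvd gez0_abs // modz_mod eqxx.
move=> i; rewrite -val_eqE /= => ne; rewrite -eqz_mod_dvd.
rewrite [(i%:Z %% _)%Z]modz_small; last by have := ltn_ord i; lia.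
by case: eqP => // E; case/eqP: ne; rewrite E.
Qed.

Lemma periodic_mulz (q : nat) (f : int -> R) (x k : int) :
  (forall y, f (y + q%:Z) = f y) -> f (x + k * q%:Z) = f x.
Proof.
move=> fq; elim: k x => [|k IH|k IH] x; first by rewrite mul0r addr0.
  by rewrite -(IH x) -[RHS]fq; congr f; rewrite intS; ring.
by rewrite -(IH x) -[LHS]fq; congr f; rewrite intS; ring.
Qed.

Lemma periodic_sum_shift (q : nat) (f : int -> R) (z : int) :
  (forall x, f (x + q%:Z) = f x) ->
  \sum_(i < q) f (z + i%:Z) = \sum_(i < q) f i%:Z.
Proof.
(* Moving the window by one exchanges [f y] for [f (y + q)]. *)
move=> fq; have S y : \sum_(i < q) f (y + 1 + i%:Z) = \sum_(i < q) f (y + i%:Z).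
  case: q fq => [|q] fq; first by rewrite !big_ord0.
  rewrite big_ord_recr big_ord_recl /= addr0 -(fq y) addrC; congr (f _ + _); first lia.
  by apply: eq_bigr => i _; rewrite /bump /= -addrA -intS.
elim: z => [|n IH|n IH].
- by apply: eq_bigr => i _; rewrite add0r.
- by rewrite -IH -(S n); apply: eq_bigr => i _; congr f; rewrite intS; ring.
- by rewrite -IH -S; apply: eq_bigr => i _; congr f; rewrite intS; ring.
Qed.

Lemma ler_sum_ord (F : nat -> R) (m n : nat) :
  (forall i, 0 <= F i) -> (m <= n)%N -> \sum_(i < m) F i <= \sum_(i < n) F i.
Proof.
move=> F0 mn; rewrite -!(big_mkord xpredT F) (big_cat_nat _ mn) //=.
by rewrite lerDl sumr_ge0.
Qed.

Lemma periodic_sum_mul (q : nat) (f : int -> R) (z : int) (k : nat) :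
  (forall x, f (x + q%:Z) = f x) ->
  \sum_(i < k * q) f (z + i%:Z) = k%:R * \sum_(i < q) f i%:Z.
Proof.
move=> fq; elim: k z => [|k IH] z; first by rewrite mul0n big_ord0 mul0r.
rewrite mulSn big_split_ord /= periodic_sum_shift // -natr1 mulrDl mul1r addrC.
congr (_ + _); rewrite -(IH (z + q%:Z)).
by apply: eq_bigr => i _; rewrite PoszD addrA.
Qed.

Lemma periodic_sum_ge (q : nat) (f : int -> R) (z : int) (h : nat) :
  (forall x, 0 <= f x) -> (forall x, f (x + q%:Z) = f x) ->
  (h %/ q)%:R * \sum_(i < q) f i%:Z <= \sum_(m < h) f (z + m%:Z).
Proof.
move=> f0 fq; rewrite -(periodic_sum_mul z) //.
by apply: (@ler_sum_ord (fun i => f (z + i%:Z))) => //; exact: leq_divM.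
Qed.

Lemma periodic_sum_le (q : nat) (f : int -> R) (z : int) (h : nat) : (0 < q)%N ->
  (forall x, 0 <= f x) -> (forall x, f (x + q%:Z) = f x) ->
  \sum_(m < h) f (z + m%:Z) <= (h %/ q).+1%:R * \sum_(i < q) f i%:Z.
Proof.
move=> q0 f0 fq; rewrite -(periodic_sum_mul z) //.
by apply: (@ler_sum_ord (fun i => f (z + i%:Z))) => //; rewrite ltnW // ltn_ceil.
Qed.

Lemma ler_divn (h q : nat) : (0 < q)%N -> (h %/ q)%:R <= h%:R / q%:R :> R.
Proof. by move=> q0; rewrite ler_pdivlMr ?ltr0n // -natrM ler_nat leq_divM. Qed.

Lemma ltr_divnS (h q : nat) : (0 < q)%N -> h%:R / q%:R <= (h %/ q).+1%:R :> R.
Proof. by move=> q0; rewrite ler_pdivrMr ?ltr0n // -natrM ler_nat ltnW // ltn_ceil. Qed.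

(** Both the sum and its expected value lie between [h %/ q] and [(h %/ q).+1] full periods, and one
    period weighs at most [q]. *)
Lemma periodic_sum_average (q : nat) (f : int -> R) (z : int) (h : nat) : (0 < q)%N ->
  (forall x, 0 <= f x <= 1) -> (forall x, f (x + q%:Z) = f x) ->
  `|\sum_(m < h) f (z + m%:Z) - h%:R * (q%:R^-1 * \sum_(i < q) f i%:Z)| <= q%:R.
Proof.
move=> q0 f01 fq; have f0 x : 0 <= f x by case/andP: (f01 x).
set S := \sum_(i < q) _.
have S0 : 0 <= S by rewrite sumr_ge0.
have Sq : S <= q%:R.
  apply: (@le_trans _ _ (\sum_(i < q) 1)); last by rewrite sumr_const card_ord.
  by apply: ler_sum => i _; case/andP: (f01 i%:Z).
have := periodic_sum_ge z h f0 fq; have := periodic_sum_le z h q0 f0 fq; rewrite -/S.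
set X := \sum_(m < h) _ => H1 H2.
have H3 : (h %/ q)%:R * S <= h%:R * (q%:R^-1 * S).
  by rewrite mulrA ler_wpM2r // ler_divn.
have H4 : h%:R * (q%:R^-1 * S) <= (h %/ q).+1%:R * S.
  by rewrite mulrA ler_wpM2r // ltr_divnS.
by rewrite ler_norml; move: H1 H2 H3 H4; rewrite -natr1 mulrDl mul1r => *; apply/andP; split; lra.
Qed.

Lemma sum_inv_sqrt (h : nat) :
  \sum_(m < h) (Num.sqrt m.+1%:R)^-1 <= 2 * Num.sqrt h%:R :> R.
Proof.
elim: h => [|h IH]; first by rewrite big_ord0 mulr_ge0 ?sqrtr_ge0.
rewrite big_ord_recr /=; apply: (le_trans (lerD IH (lexx _))).
set a := Num.sqrt h%:R; set b := Num.sqrt h.+1%:R.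
have b0 : 0 < b by rewrite sqrtr_gt0 ltr0n.
have bE : b ^+ 2 = a ^+ 2 + 1 by rewrite !sqr_sqrtr ?ler0n // natr1.
(* The sum telescopes: [1 / b <= 2 (b - a)] follows from [b^2 - a^2 = 1] and [(b - a)^2 >= 0]. *)
rewrite -lerBrDl -(ler_pM2r b0) mulVf ?gt_eqF //.
have := sqr_ge0 (b - a); nra.
Qed.

End PeriodicSums.

(** * Equidistribution of the walk modulo [q] and averages of periodic functions *)

Section Equidistribution.
Variables (R : realType) (al : R).
Hypothesis al01 : 0 < al < 1.
Local Notation T := (walk_op al).
Local Notation c := (smooth_cst al).

(** The difference of the two class indicators telescopes into the gradient of [G], which counts the
    members of at most [q] consecutive classes containing a given integer. Hence [0 <= G <= 1], and
    the bound depends on neither [q] nor [j]. *)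
Lemma walk_op_residue_diff (q : nat) (a : int) (j m : nat) x : (0 < q)%N -> (j <= q)%N ->
  `|iter m T (fun y => ((q%:Z %| y.1 - a)%Z)%:R) x -
    iter m T (fun y => ((q%:Z %| y.1 - a - j%:Z)%Z)%:R) x| <= c / Num.sqrt m.+1%:R.
Proof.
move=> q0 jq; rewrite -iter_walk_opB.
pose F i (y : int) : R := ((q%:Z %| y - a - i%:Z)%Z)%:R.
(* The shift by 1 makes the two terms of the gradient the sums of [F i y.1] and of [F i.+1 y.1]. *)
pose G (y : pt) : R := \sum_(i < j) F i (y.1 - 1).
have -> : iter m T (fun y => ((q%:Z %| y.1 - a)%Z)%:R - ((q%:Z %| y.1 - a - j%:Z)%Z)%:R) x
   = iter m T (diag_diff G) x.
  apply: eq_iter_walk_op_on => // y _; rewrite /diag_diff /G /=.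
  transitivity (\sum_(i < j) (F i y.1 - F i.+1 y.1)).
    elim: (j) => [|k IH]; first by rewrite big_ord0 subr0 subrr.
    by rewrite big_ord_recr /= -IH /F; ring.
  rewrite sumrB; congr (_ - _); apply: eq_bigr => i _; rewrite /F; congr (_%:R); congr (nat_of_bool _);
    congr (_ %| _)%Z; rewrite ?intS; ring.
apply: walk_op_smooth => // y; rewrite ger0_norm ?sumr_ge0 //.
rewrite -[X in _ <= X](@sum_dvdz_window R q (y.1 - 1 - a) q0).
exact: (@ler_sum_ord R (fun i => F i (y.1 - 1))).
Qed.

(** The probabilities of the [q] classes sum to 1 and each is close to that of the class of [a], so
    the latter is close to their average [1 / q]. *)
Lemma walk_op_residue (q : nat) (a : int) (m : nat) x : (0 < q)%N ->
  `|iter m T (fun y => ((q%:Z %| y.1 - a)%Z)%:R) x - q%:R^-1| <= c / Num.sqrt m.+1%:R.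
Proof.
move=> q0; set S := iter _ _ _ _; have qR : 0 < q%:R :> R by rewrite ltr0n.
have E : \sum_(j < q) iter m T (fun y => ((q%:Z %| y.1 - a - j%:Z)%Z)%:R) x = 1.
  rewrite -iter_walk_op_sum // -[RHS](iter_walk_op_cst al m 1 x).
  by apply: eq_iter_walk_op_on => // y _; rewrite sum_dvdz_window.
rewrite -(ler_pM2l qR) -{1}(gtr0_norm qR) -normrM mulrBr mulfV ?gt_eqF //.
have -> : q%:R * S - 1 =
    \sum_(j < q) (S - iter m T (fun y => ((q%:Z %| y.1 - a - j%:Z)%Z)%:R) x).
  by rewrite sumrB E sumr_const card_ord mulr_natl.
rewrite (le_trans (ler_norm_sum _ _ _)) //.
apply: (@le_trans _ _ (\sum_(j < q) c / Num.sqrt m.+1%:R)).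
  by apply: ler_sum => j _; apply: walk_op_residue_diff => //; rewrite ltnW.
by rewrite sumr_const card_ord mulr_natl.
Qed.

(** The indicator of a vertical line is the gradient of the indicator of the half-plane to its
    right. *)
Lemma walk_op_point (a : int) (m : nat) x :
  iter m T (fun y => (y.1 == a)%:R) x <= c / Num.sqrt m.+1%:R.
Proof.
have -> : iter m T (fun y => (y.1 == a)%:R) x =
    iter m T (diag_diff (fun y => (a < y.1)%R%:R)) x.
  apply: eq_iter_walk_op_on => // y _; rewrite /diag_diff /=.
  have -> : (a < y.1 + 1)%R = (a < y.1)%R || (y.1 == a) by lia.
  by case: (ltrgtP a y.1); rewrite ?subrr ?subr0.
apply: (le_trans (ler_norm _)); apply: walk_op_smooth => // y.
by case: (a < y.1)%R; rewrite ?normr1 ?normr0.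
Qed.

Lemma sum_smooth_bound (h : nat) :
  \sum_(m < h) c / Num.sqrt m.+2%:R <= 2 * c * Num.sqrt h%:R.
Proof.
have c0 := smooth_cst_gt0 al01; rewrite -mulr_sumr -mulrA mulrCA ler_pM2l //.
apply: le_trans (sum_inv_sqrt R h); apply: ler_sum => m _.
by rewrite lef_pV2 ?posrE ?sqrtr_gt0 ?ltr0n // ler_wsqrtr // ler_nat.
Qed.

(** At a given time [g] depends only on the first coordinate modulo [q], which is nearly uniform, so
    the mean of [g] is nearly a periodic function [phi] of the time. Averaging [phi] over the block
    gives the two-dimensional mean. *)
Lemma walk_op_periodic (q h : nat) (g : pt -> R) x : (0 < q)%N ->
  (forall y, 0 <= g y <= 1) ->
  (forall y z, g (y + q%:Z, z) = g (y, z)) ->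
  (forall y z, g (y, z + q%:Z) = g (y, z)) ->
  `|\sum_(m < h) iter m.+1 T g x -
    h%:R * (q%:R ^- 2 * \sum_(a < q) \sum_(b < q) g (a%:Z, b%:Z))| <=
  q%:R + q%:R * (2 * c * Num.sqrt h%:R).
Proof.
move=> q0 g01 g1 g2; have qR : 0 < q%:R :> R by rewrite ltr0n.
have g1k y z k : g (y + k * q%:Z, z) = g (y, z).
  exact: (periodic_mulz y k (f := fun t => g (t, z))).
have g2k y z k : g (y, z + k * q%:Z) = g (y, z).
  exact: (periodic_mulz z k (f := fun t => g (y, t))).
pose phi (t : int) : R := q%:R^-1 * \sum_(a < q) g (a%:Z, t - a%:Z).
have phi01 t : 0 <= phi t <= 1.
  have H0 : 0 <= \sum_(a < q) g (a%:Z, t - a%:Z).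
    by apply: sumr_ge0 => a _; case/andP: (g01 (a%:Z, t - a%:Z)).
  apply/andP; split; first by rewrite mulr_ge0 // invr_ge0 ler0n.
  rewrite /phi mulrC ler_pdivrMr // mul1r.
  apply: (@le_trans _ _ (\sum_(i < q) 1)); last by rewrite sumr_const card_ord.
  by apply: ler_sum => a _; case/andP: (g01 (a%:Z, t - a%:Z)).
have phiq t : phi (t + q%:Z) = phi t.
  by congr (_ * _); apply: eq_bigr => a _; rewrite addrAC g2.
(* The substitution [b = t - a] identifies the mean over the square with the mean of [phi] over a
   period. *)
have -> : q%:R ^- 2 * \sum_(a < q) \sum_(b < q) g (a%:Z, b%:Z)
    = q%:R^-1 * \sum_(i < q) phi i%:Z.
  rewrite -mulr_sumr mulrA -expr2 exprVn exchange_big /=; congr (_ * _).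
  rewrite exchange_big [RHS]exchange_big /=; apply: eq_bigr => a _.
  rewrite -(@periodic_sum_shift R q (fun t => g (a%:Z, t)) (- a%:Z)) //.
  by apply: eq_bigr => b _; rewrite addrC.
set s := x.1 + x.2.
have E m : `|iter m.+1 T g x - phi (s + 1 + m%:Z)| <= q%:R * (c / Num.sqrt m.+2%:R).
  (* Split by the residue [a] of [y.1]; periodicity in both variables moves [y] along its
     antidiagonal to the point with first coordinate [a]. *)
  have -> : iter m.+1 T g x = \sum_(a < q) g (a%:Z, s + 1 + m%:Z - a%:Z) *
      iter m.+1 T (fun y => ((q%:Z %| y.1 - a%:Z)%Z)%:R) x.
    under [RHS]eq_bigr => a _ do rewrite -iter_walk_opZ.
    rewrite -iter_walk_op_sum //; apply: eq_iter_walk_op_on => // y yE.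
    rewrite -[LHS]mulr1 -[X in _ * X = _](@sum_dvdz_window R q y.1 q0) mulr_sumr.
    apply: eq_bigr => a _; case D : (_ %| _)%Z; last by rewrite !mulr0.
    congr (_ * _); case/dvdzP: D => k kE.
    rewrite (_ : y = (y.1, y.2)); last by case: (y).
    rewrite -(g1k _ _ (- k)) -(g2k _ _ k); congr (g (_, _)); first by rewrite mulNr -kE; ring.
    rewrite -kE; move: yE; rewrite -/s intS => yE; have -> : y.2 = s + (1 + m%:Z) - y.1 by rewrite -yE; ring.
    ring.
  rewrite /phi mulr_sumr -sumrB (le_trans (ler_norm_sum _ _ _)) //.
  apply: (@le_trans _ _ (\sum_(a < q) c / Num.sqrt m.+2%:R)); last first.
    by rewrite sumr_const card_ord mulr_natl.
  apply: ler_sum => a _; rewrite [q%:R^-1 * _]mulrC -mulrBr normrM.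
  apply: le_trans (walk_op_residue a%:Z m.+1 x q0).
  rewrite ler_piMl ?normr_ge0 //.
  by have /andP[? ?] := g01 (a%:Z, s + 1 + m%:Z - a%:Z); rewrite ger0_norm.
have := periodic_sum_average (s + 1) h q0 phi01 phiq.
set A := _^-1 * _; set B := \sum_(m < h) phi _ => H.
rewrite (_ : _ - _ = (B - h%:R * A) + (\sum_(m < h) iter m.+1 T g x - B)); last by ring.
rewrite (le_trans (ler_normD _ _)) // lerD //.
rewrite -sumrB (le_trans (ler_norm_sum _ _ _)) //.
apply: (@le_trans _ _ (\sum_(m < h) q%:R * (c / Num.sqrt m.+2%:R))); first by apply: ler_sum.
by rewrite -mulr_sumr ler_pM2l // sum_smooth_bound.
Qed.
End Equidistribution.

(** * Arithmetic of visibility *)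

Section Visibility.
Variables b1 b2 : nat.
Hypotheses (b1_gt0 : (0 < b1)%N) (b2_gt0 : (0 < b2)%N).

(** For [b1 = b2 = 1] this says that [p] divides the gcd of the coordinates of [x - u]. *)
Definition blocks_at (p : nat) (x u : pt) : bool :=
  ((p ^ b1)%N%:Z %| x.1 - u.1)%Z && ((p ^ b2)%N%:Z %| x.2 - u.2)%Z.

Lemma between_scaled (a r : int) (q : nat) : (0 < q)%N -> between (a + r * q%:Z) a (a + r).
Proof.
move=> q0; have q1 : 1 <= q%:Z by lia.
rewrite /between; case: (lerP 0 r) => r0.
  have : r <= r * q%:Z by rewrite ler_peMr.
  lia.
have : r * q%:Z <= r by rewrite -lerN2 -mulNr ler_peMr // oppr_ge0 ltW.
lia.
Qed.

Lemma between_absz (a b c : int) : between a b c -> (`|c - b| <= `|a - b|)%N.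
Proof. by rewrite /between; lia. Qed.

Lemma between_absz_eq (a b c : int) : between a b c ->
  (`|c - b| = `|a - b|)%N -> c = a.
Proof. by rewrite /between; lia. Qed.

(* The arc from [u] to [x] is parametrised by [s] in [0, 1] as
   [u + (s^b1 (x.1-u.1), s^b2 (x.2-u.2))]; the blocking point is at [s = 1/p]. *)
Lemma bvisible_not_blocked (p : nat) (x u : pt) :
  bvisible b1 b2 x u -> prime p -> ~~ blocks_at p x u.
Proof.
move=> [xu vis] p_pr; apply/negP => /andP[/dvdzP[r rE] /dvdzP[t tE]].
have p1 := prime_gt1 p_pr.
have q1 : (1 < p ^ b1)%N by rewrite -(exp1n b1) ltn_exp2r.
have q2 : (1 < p ^ b2)%N by rewrite -(exp1n b2) ltn_exp2r.
have xE : x = (u.1 + r * (p ^ b1)%N%:Z, u.2 + t * (p ^ b2)%N%:Z).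
  by rewrite -rE -tE; case: (x) (u) => [? ?] [? ?] /=; congr pair; ring.
have rt : (r != 0) || (t != 0).
  apply/negPn; rewrite negb_or !negbK; apply/negP => /andP[/eqP r0 /eqP t0].
  by apply: xu; rewrite xE r0 t0 !mul0r !addr0; case: (u).
(* These are [(x.1 - u.1)^b2] and [(x.2 - u.2)^b1], the natural coefficients of the curve through
   [u] and [x]. *)
pose a1 : rat := (r%:~R * p%:R ^+ b1) ^+ b2; pose a2 : rat := (t%:~R * p%:R ^+ b2) ^+ b1.
have pR : p%:R != 0 :> rat by rewrite pnatr_eq0 -lt0n prime_gt0.
apply: (vis a1 a2 _ _ _ (u.1 + r, u.2 + t)).
- move=> [/eqP] ; rewrite /a1 /a2 expf_eq0 b2_gt0 /= mulf_eq0 expf_eq0 (negbTE pR) andbF orbF.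
  rewrite intr_eq0 => r0 /eqP; rewrite expf_eq0 b1_gt0 /= mulf_eq0 expf_eq0 (negbTE pR) andbF orbF.
  by rewrite intr_eq0 => t0; move: rt; rewrite r0 t0.
- by rewrite /on_curve !subrr /= !expr0n !gtn_eqF // !mulr0.
- rewrite /on_curve rE tE /a1 /a2 !rmorphM /= !pmulrn -!pmulrn !natrX mulrC; ring.
- move=> E; case/orP: rt => /eqP; apply.
    have : r * ((p ^ b1)%N%:Z - 1) = 0 by move: (congr1 fst E); rewrite xE mulrBr /=; lia.
    by move=> /eqP; rewrite mulf_eq0 => /orP[/eqP //|]; lia.
  have : t * ((p ^ b2)%N%:Z - 1) = 0 by move: (congr1 snd E); rewrite xE mulrBr /=; lia.
  by move=> /eqP; rewrite mulf_eq0 => /orP[/eqP //|]; lia.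
- move=> E; case/orP: rt => /eqP; apply.
    by move: (congr1 fst E) => /=; lia.
  by move: (congr1 snd E) => /=; lia.
- by rewrite xE; apply: between_scaled; lia.
- by rewrite xE; apply: between_scaled; lia.
- rewrite /on_curve /a1 /a2 /=.
  rewrite (_ : u.1 + r - u.1 = r); last by ring.
  rewrite (_ : u.2 + t - u.2 = t); last by ring.
  by rewrite !exprMn -!exprM [(b2 * b1)%N]mulnC; ring.
Qed.

Hypothesis b_coprime : coprime b1 b2.

(** As [X] does not divide [r], some prime [p] has larger valuation in [X] than in [r]. Comparing
    valuations, [b2] times the excess of [X] over [r] equals [b1] times the excess of [Y] over [t];
    coprimality makes the two positive excesses multiples of [b1] and [b2] respectively. *)
Lemma common_power_divisor (X Y r t : nat) :
  (0 < r < X)%N -> (0 < t)%N -> (0 < Y)%N ->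
  (t ^ b1 * X ^ b2 = r ^ b2 * Y ^ b1)%N ->
  exists p, [/\ prime p, p ^ b1 %| X & p ^ b2 %| Y]%N.
Proof.
move=> /andP[r0 rX] t0 Y0 E; have X0 : (0 < X)%N by apply: ltn_trans rX.
have [p p_pr plt] : exists2 p, prime p & (logn p r < logn p X)%N.
  have nX : ~~ (X %| r)%N by apply/negP => /(dvdn_leq r0); rewrite leqNgt rX.
  apply: contrapT => H; case/negP: nX; apply/(dvdn_partP _ X0) => p; rewrite mem_primes => /andP[p_pr _].
  rewrite p_part pfactor_dvdn // leqNgt; apply/negP => plt; apply: H; by exists p.
exists p; rewrite p_pr !pfactor_dvdn //.
have : (b1 * logn p t + b2 * logn p X = b2 * logn p r + b1 * logn p Y)%N.
  by move: (congr1 (logn p) E); rewrite !lognM ?expn_gt0 ?r0 ?t0 ?X0 ?Y0 // !lognX.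
move: plt; set lt := logn p t; set lX := logn p X; set lr := logn p r; set lY := logn p Y.
move=> plt EL.
have E2 : (b2 * (lX - lr) = b1 * (lY - lt))%N by rewrite !mulnBr; lia.
have d1 : (b1 %| lX - lr)%N by rewrite -(Gauss_dvdr _ b_coprime) E2 dvdn_mulr.
have d2 : (b2 %| lY - lt)%N by rewrite -(@Gauss_dvdr _ b1) 1?coprime_sym // -E2 dvdn_mulr.
have lt1 : (0 < lX - lr)%N by rewrite subn_gt0.
have lt2 : (0 < lY - lt)%N.
  by rewrite lt0n; apply: contraTneq lt1 => E0; move: E2; rewrite E0 muln0 => /eqP; lia.
by split=> //; [apply: leq_trans (dvdn_leq lt1 d1) _|apply: leq_trans (dvdn_leq lt2 d2) _]; apply: leq_subr.
Qed.

(** A lattice point inside the arc would yield a blocking prime by [common_power_divisor]. Off the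
    two lines through [u] both coefficients of the curve are nonzero and can be cancelled. *)
Lemma unblocked_bvisible (x u : pt) : x.1 != u.1 -> x.2 != u.2 ->
  (forall p, prime p -> ~~ blocks_at p x u) -> bvisible b1 b2 x u.
Proof.
move=> x1 x2 nb; split=> [E|]; first by rewrite E eqxx in x1.
move=> a1 a2 a0 _ onP z zx zu btw1 btw2 onz.
set X := x.1 - u.1; set Y := x.2 - u.2; set r := z.1 - u.1; set t := z.2 - u.2.
have X0 : X != 0 by rewrite subr_eq0.
have Y0 : Y != 0 by rewrite subr_eq0.
have XR : X%:~R ^+ b2 != 0 :> rat by rewrite expf_neq0 // intr_eq0.
have YR : Y%:~R ^+ b1 != 0 :> rat by rewrite expf_neq0 // intr_eq0.
move: onP onz; rewrite /on_curve -/X -/Y -/r -/t => onP onz.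
have a1n : a1 != 0.
  apply/eqP => a10; apply: a0; rewrite a10; congr pair; move: onP; rewrite a10 mul0r.
  by move/esym/eqP; rewrite mulf_eq0 (negbTE XR) orbF => /eqP.
have a2n : a2 != 0.
  apply/eqP => a20; apply: a0; rewrite a20; congr pair; move: onP; rewrite a20 mul0r.
  by move/eqP; rewrite mulf_eq0 (negbTE YR) orbF => /eqP.
have E : t ^+ b1 * X ^+ b2 = r ^+ b2 * Y ^+ b1.
  apply/eqP; rewrite -(eqr_int rat) !rmorphM /= !rmorphXn /=; apply/eqP.
  apply: (mulfI (mulf_neq0 a1n a2n)).
  transitivity ((a1 * t%:~R ^+ b1) * (a2 * X%:~R ^+ b2)); first by ring.
  by rewrite onz -onP; ring.
have En : (`|t| ^ b1 * `|X| ^ b2 = `|r| ^ b2 * `|Y| ^ b1)%N.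
  by move: (congr1 absz E); rewrite !abszM !abszX.
have rX : (`|r| <= `|X|)%N.
  exact: between_absz.
have tY : (`|t| <= `|Y|)%N.
  exact: between_absz.
have r0 : r != 0.
  apply/eqP => r0; have /eqP : t ^+ b1 * X ^+ b2 = 0 by rewrite E r0 expr0n gtn_eqF // mul0r.
  rewrite mulf_eq0 !expf_eq0 (negbTE X0) andbF orbF => /andP[_ /eqP t0].
  by apply: zu; rewrite [z]surjective_pairing (subr0_eq r0) (subr0_eq t0) -surjective_pairing.
have t0 : t != 0.
  apply/eqP => t0; have /eqP : r ^+ b2 * Y ^+ b1 = 0 by rewrite -E t0 expr0n gtn_eqF // mul0r.
  by rewrite mulf_eq0 !expf_eq0 (negbTE Y0) (negbTE r0) !andbF.
(* Equality of the horizontal displacements forces equality of the vertical ones, and then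
   [z = x]. *)
have rX' : (`|r| < `|X|)%N.
  rewrite ltn_neqAle rX andbT; apply/eqP => rXE.
  have : (`|t| ^ b1 = `|Y| ^ b1)%N.
    apply/eqP; rewrite -(@eqn_pmul2r (`|X| ^ b2)%N) ?expn_gt0 ?absz_gt0 ?X0 // En rXE mulnC.
    by rewrite eqxx.
  move=> /eqP; rewrite eqn_exp2r // => /eqP tYE.
  apply: zx; rewrite [z]surjective_pairing (between_absz_eq btw1 rXE).
  by rewrite (between_absz_eq btw2 tYE) -surjective_pairing.
have [|||p [p_pr d1 d2]] := @common_power_divisor `|X| `|Y| `|r| `|t| _ _ _ En.
- by rewrite rX' absz_gt0 r0.
- by rewrite absz_gt0.
- by rewrite absz_gt0.
by move: (nb _ p_pr); rewrite /blocks_at !dvdzE /= d1 d2.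
Qed.
End Visibility.

(** * Means of periodic functions and local densities *)

Section PeriodicMeans.
Variable R : realType.

Definition period (q : nat) (g : pt -> R) : Prop :=
  (forall y z, g (y + q%:Z, z) = g (y, z)) /\ (forall y z, g (y, z + q%:Z) = g (y, z)).

Definition mean2 (q : nat) (g : pt -> R) : R :=
  q%:R ^- 2 * \sum_(a < q) \sum_(b < q) g (a%:Z, b%:Z).

Lemma periodic_eq_mod (q : nat) (f : int -> R) (x y : int) :
  (forall y, f (y + q%:Z) = f y) -> (q%:Z %| x - y)%Z -> f x = f y.
Proof.
move=> fq /dvdzP[k kE]; rewrite -(periodic_mulz y k fq) -kE; congr f; ring.
Qed.

Lemma sum_dvdz_window_sym (q : nat) (z : int) : (0 < q)%N ->
  \sum_(i < q) ((q%:Z %| i%:Z - z)%Z)%:R = 1 :> R.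
Proof.
move=> q0; rewrite -[RHS](sum_dvdz_window R z q0); apply: eq_bigr => i _.
by rewrite !dvdzE -opprB abszN.
Qed.

(** By Chinese remainders the diagonal modulo [q1 * q2] meets each pair of residues exactly once. *)
Lemma sum_chinese (q1 q2 : nat) (F : int -> int -> R) :
  (0 < q1)%N -> (0 < q2)%N -> coprime q1 q2 ->
  (forall x y, F (x + q1%:Z) y = F x y) -> (forall x y, F x (y + q2%:Z) = F x y) ->
  \sum_(a < q1 * q2) F a%:Z a%:Z = \sum_(i < q1) \sum_(j < q2) F i%:Z j%:Z.
Proof.
move=> q1_gt0 q2_gt0 q12 F1 F2.
transitivity (\sum_(a < q1 * q2) \sum_(i < q1) \sum_(j < q2)
   F i%:Z j%:Z * (((q1%:Z %| a%:Z - i%:Z)%Z)%:R * ((q2%:Z %| a%:Z - j%:Z)%Z)%:R)).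
  apply: eq_bigr => a _; rewrite -[LHS]mulr1 -[X in _ * X](mulr1 1).
  rewrite -[X in _ * (X * _)](sum_dvdz_window R a%:Z q1_gt0).
  rewrite -[X in _ * (_ * X)](sum_dvdz_window R a%:Z q2_gt0).
  rewrite big_distrlr mulr_sumr; apply: eq_bigr => i _.
  rewrite mulr_sumr; apply: eq_bigr => j _.
  case D1 : (q1%:Z %| _)%Z; last by rewrite /= mul0r !mulr0.
  case D2 : (q2%:Z %| _)%Z; last by rewrite /= !mulr0.
  congr (_ * _); rewrite (@periodic_eq_mod q1 (F^~ a%:Z) _ _ (F1^~ a%:Z) D1).
  exact: (@periodic_eq_mod q2 (F i%:Z) _ _ (F2 i%:Z) D2).
rewrite exchange_big; apply: eq_bigr => i _; rewrite exchange_big; apply: eq_bigr => j _.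
rewrite -mulr_sumr /= -[RHS]mulr1; congr (_ * _).
have q12z : coprimez q1%:Z q2%:Z by [].
rewrite -[RHS](@sum_dvdz_window_sym (q1 * q2) (zchinese q1%:Z q2%:Z i%:Z j%:Z)) ?muln_gt0 ?q1_gt0 //.
apply: eq_bigr => a _; rewrite -natrM mulnb; congr (_%:R); congr nat_of_bool.
rewrite -!eqz_mod_dvd PoszM zchinese_remainder // zchinese_modl // zchinese_modr //.
Qed.

(** Independence of coprime moduli: [sum_chinese] is applied to each coordinate in turn. *)
Lemma mean2M (q1 q2 : nat) (g1 g2 : pt -> R) : (0 < q1)%N -> (0 < q2)%N ->
  coprime q1 q2 -> period q1 g1 -> period q2 g2 ->
  mean2 (q1 * q2) (fun x => g1 x * g2 x) = mean2 q1 g1 * mean2 q2 g2.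
Proof.
move=> q1_gt0 q2_gt0 q12 [g11 g12] [g21 g22].
rewrite /mean2 natrM exprMn invfM mulrACA; congr (_ * _).
transitivity (\sum_(a < q1 * q2) \sum_(i < q1) \sum_(j < q2) g1 (a%:Z, i%:Z) * g2 (a%:Z, j%:Z)).
  apply: eq_bigr => a _.
  by apply: (@sum_chinese _ _ (fun x y => g1 (a%:Z, x) * g2 (a%:Z, y))) => // x y; rewrite ?g12 ?g22.
rewrite exchange_big /=.
transitivity (\sum_(i < q1) \sum_(j < q2) \sum_(k < q1) \sum_(l < q2) g1 (k%:Z, i%:Z) * g2 (l%:Z, j%:Z)).
  apply: eq_bigr => i _; rewrite exchange_big; apply: eq_bigr => j _ /=.
  by apply: (@sum_chinese _ _ (fun x y => g1 (x, i%:Z) * g2 (y, j%:Z))) => // x y; rewrite ?g11 ?g21.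
rewrite [X in _ = X * _]exchange_big [X in _ = _ * X]exchange_big big_distrlr /=.
by apply: eq_bigr => i _; apply: eq_bigr => j _; rewrite big_distrlr.
Qed.
End PeriodicMeans.

(** * Density of unblocked points at one prime, and the truncated Euler product *)

Section LocalDensities.
Variables (R : realType) (b1 b2 : nat) (W : seq pt).
Hypotheses (b1_gt0 : (0 < b1)%N) (b2_gt0 : (0 < b2)%N).
Hypotheses (W_uniq : uniq W) (W_star : condition_star b1 b2 W).

Definition unblocked_at (p : nat) (x : pt) : R :=
  (all (fun u => ~~ blocks_at b1 b2 p x u) W)%:R.

Definition trunc_visible (M : nat) (x : pt) : R :=
  \prod_(p < M | prime p) unblocked_at p x.

(** The exponent [b1 + b2] is at least [b1] and [b2], so one modulus serves both coordinates. *)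
Definition trunc_period (M : nat) : nat := \prod_(p < M | prime p) p ^ (b1 + b2).

Lemma blocks_at_trans p x u v :
  blocks_at b1 b2 p x u -> blocks_at b1 b2 p x v -> blocks_at b1 b2 p u v.
Proof.
move=> /andP[d1 d2] /andP[e1 e2]; rewrite /blocks_at.
rewrite (_ : u.1 - v.1 = (x.1 - v.1) - (x.1 - u.1)); last by ring.
rewrite (_ : u.2 - v.2 = (x.2 - v.2) - (x.2 - u.2)); last by ring.
by apply/andP; split; apply: rpredB.
Qed.

(* Condition (star) makes the residue classes of [W] modulo [(p^b1, p^b2)] distinct. *)
Lemma unblocked_atE p x : prime p ->
  unblocked_at p x = 1 - \sum_(u <- W) (blocks_at b1 b2 p x u)%:R.
Proof.
move=> p_pr; rewrite /unblocked_at.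
have : forall u v, u \in W -> v \in W -> u <> v ->
    blocks_at b1 b2 p x u -> ~~ blocks_at b1 b2 p x v.
  move=> u v uW vW uv bu; apply/negP => bv; have vis := W_star uW vW uv.
  by case/negP: (bvisible_not_blocked b1_gt0 b2_gt0 vis p_pr); exact: blocks_at_trans bu bv.
elim: W W_uniq => [|w s IH] /=; first by rewrite big_nil subr0.
move=> /andP[ws s_uniq] H; rewrite big_cons.
have {}IH := IH s_uniq (fun u v us vs => H u v (mem_behead (s := w :: s) us) (mem_behead (s := w :: s) vs)).
case bw : (blocks_at b1 b2 p x w) => /=; last by rewrite add0r IH.
rewrite big_seq big1 ?addr0 ?subrr // => v vs.
rewrite (negbTE (H w v _ _ _ bw)) ?inE ?eqxx ?vs ?orbT //.
by move=> E; rewrite E vs in ws.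
Qed.

Lemma period_unblocked_at p : period (p ^ (b1 + b2)) (unblocked_at p).
Proof.
split=> y z; rewrite /unblocked_at; congr (_%:R); congr nat_of_bool;
  apply: eq_all => u; rewrite /blocks_at /=; congr (~~ (_ && _)).
  rewrite (_ : _ - _ = (y - u.1) + (p ^ (b1 + b2))%N%:Z); last by ring.
  by rewrite rpredDr // dvdzE /= expnD dvdn_mulr.
rewrite (_ : _ - _ = (z - u.2) + (p ^ (b1 + b2))%N%:Z); last by ring.
by rewrite rpredDr // dvdzE /= expnD dvdn_mull.
Qed.

Lemma sum_dvdz_mul (q k : nat) (u : int) : (0 < q)%N ->
  \sum_(i < k * q) ((q%:Z %| i%:Z - u)%Z)%:R = k%:R :> R.
Proof.
move=> q0; pose f (x : int) : R := ((q%:Z %| x - u)%Z)%:R.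
have fq x : f (x + q%:Z) = f x.
  rewrite /f (_ : _ - _ = (x - u) + q%:Z); last by ring.
  by rewrite rpredDr ?dvdzz.
transitivity (\sum_(i < k * q) f (0 + i%:Z)); first by apply: eq_bigr => i _; rewrite add0r.
by rewrite periodic_sum_mul // sum_dvdz_window_sym // mulr1.
Qed.

Lemma mean2_unblocked_at p : prime p ->
  mean2 (p ^ (b1 + b2)) (unblocked_at p) = 1 - (size W)%:R / p%:R ^+ (b1 + b2).
Proof.
move=> p_pr; have p0 := prime_gt0 p_pr; rewrite /mean2.
have pR : p%:R != 0 :> R by rewrite pnatr_eq0 -lt0n.
set q := (p ^ (b1 + b2))%N; have qR : q%:R = p%:R ^+ (b1 + b2) :> R by rewrite natrX.
have qR0 : q%:R != 0 :> R by rewrite qR expf_neq0.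
(* Each [u] blocks [p^b2] residues [a] times [p^b1] residues [b], that is [q] of the [q^2] pairs,
   and these sets are disjoint. *)
have -> : \sum_(a < q) \sum_(b < q) unblocked_at p (a%:Z, b%:Z) =
    q%:R ^+ 2 - (size W)%:R * q%:R.
  under eq_bigr => a _ do under eq_bigr => b _ do rewrite unblocked_atE //.
  under eq_bigr => a _ do rewrite sumrB exchange_big sumr_const card_ord.
  rewrite sumrB sumr_const card_ord exchange_big /=; congr (_ - _).
    by rewrite -mulrnA natrM expr2.
  rewrite -sum1_size natr_sum mulr_suml; apply: eq_bigr => u _; rewrite mul1r.
  transitivity ((\sum_(a < q) (((p ^ b1)%N%:Z %| a%:Z - u.1)%Z)%:R) *
                (\sum_(b < q) (((p ^ b2)%N%:Z %| b%:Z - u.2)%Z)%:R) : R).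
    rewrite big_distrlr; apply: eq_bigr => a _; apply: eq_bigr => b _ /=.
    by rewrite -natrM mulnb.
  have -> : q = (p ^ b2 * p ^ b1)%N by rewrite -expnD addnC.
  rewrite sum_dvdz_mul ?expn_gt0 ?p0 // mulnC sum_dvdz_mul ?expn_gt0 ?p0 //.
  by rewrite -natrM mulnC.
rewrite mulrBr mulVf ?expf_neq0 // -qR; congr (_ - _); field.
by [].
Qed.

Lemma trunc_period_gt0 M : (0 < trunc_period M)%N.
Proof. by apply: prodn_cond_gt0 => p p_pr; rewrite expn_gt0 prime_gt0. Qed.

Lemma period_mull q k g : @period R q g -> period (k * q) g.
Proof.
move=> [g1 g2]; split=> y z; rewrite PoszM.
  exact: (periodic_mulz y k (f := fun x => g (x, z))).
exact: (periodic_mulz z k (f := fun x => g (y, x))).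
Qed.

(** Induction on the cutoff: a new prime contributes a factor whose period is coprime to the
    preceding ones, so the means multiply. *)
Lemma mean2_trunc_visible M :
  period (trunc_period M) (trunc_visible M) /\
  mean2 (trunc_period M) (trunc_visible M) = prime_partial_prod R (size W) (b1 + b2) M.
Proof.
elim: M => [|M [IHper IH]].
  rewrite /mean2 /trunc_period /trunc_visible /prime_partial_prod !big_ord0.
  split; first by split=> y z; rewrite !big_ord0.
  by rewrite !big_ord1 big_ord0 expr1n invr1 mulr1.
rewrite /prime_partial_prod big_mkcond big_ord_recr /= -big_mkcond -/(prime_partial_prod _ _ _ _) -IH.
have -> : trunc_period M.+1 = (trunc_period M * if prime M then M ^ (b1 + b2) else 1)%N.
  by rewrite /trunc_period big_mkcond big_ord_recr /= -big_mkcond.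
have -> : trunc_visible M.+1 = fun x => trunc_visible M x * if prime M then unblocked_at M x else 1.
  by apply/funext => x; rewrite /trunc_visible big_mkcond big_ord_recr /= -big_mkcond.
case: ifP => M_pr; last first.
  rewrite muln1 mulr1 (_ : (fun x => _) = trunc_visible M) //.
  by apply/funext => x; rewrite mulr1.
have [u1 u2] := period_unblocked_at M.
split.
  have [h1 h2] : period (trunc_period M * M ^ (b1 + b2)) (unblocked_at M) by apply: period_mull.
  have [h3 h4] : period (trunc_period M * M ^ (b1 + b2)) (trunc_visible M).
    by rewrite mulnC; apply: period_mull.
  by split=> y z; rewrite ?h1 ?h2 ?h3 ?h4.
rewrite mean2M ?mean2_unblocked_at ?trunc_period_gt0 ?expn_gt0 ?prime_gt0 //.
rewrite coprimeXr // /trunc_period.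
apply: (big_ind (fun a => coprime a M)) => [||p p_pr]; first by rewrite coprime1n.
  by move=> a b ha hb; rewrite coprimeMl ha.
rewrite coprimeXl // prime_coprime // dvdn_prime2 //.
by rewrite neq_ltn ltn_ord.
Qed.

Lemma trunc_visible01 M x : 0 <= trunc_visible M x <= 1.
Proof.
apply/andP; split; first by apply: prodr_ge0.
apply: prodr_ile1 => p _; rewrite ler0n /= /unblocked_at.
by case: (all _ _).
Qed.
End LocalDensities.

(** * Large primes *)

Section PrimeDivisors.

Lemma exp2_size_primes (n : nat) : (0 < n)%N -> (2 ^ size (primes n) <= n)%N.
Proof.
move=> n0; rewrite /primes size_map {2}(prod_prime_decomp n0).
rewrite -sum1_size expn_sum !big_seq; apply: leq_prod => f.
case: f => p e /mem_prime_decomp[p_pr e0 _] /=.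
by rewrite expn1 (leq_trans (prime_gt1 p_pr)) // -{1}(expn1 p) leq_exp2l // prime_gt1.
Qed.

(** A crude form of the logarithmic bound: with [v = w %/ 8], the chain
    [v^8 <= 2^(8 v) <= 2^w <= n <= a^8] gives [v <= a]. *)
Lemma size_primes_bound (n a : nat) : (0 < n)%N -> (n <= a ^ 8)%N ->
  (size (primes n) <= 8 * a.+1)%N.
Proof.
move=> n0 na; have H := exp2_size_primes n0; set w := size _ in H *.
have : ((w %/ 8) ^ 8 <= a ^ 8)%N.
  apply: leq_trans (leq_trans H na).
  apply: (@leq_trans ((2 ^ (w %/ 8)) ^ 8)%N).
    by rewrite leq_exp2r // ltnW // ltn_expl.
  by rewrite -expnM leq_exp2l // leq_divM.
rewrite leq_exp2r // => wa.
by rewrite ltnW // mulnC (leq_trans (ltn_ceil w (isT : 0 < 8)%N)) // leq_mul2r ltnS wa.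
Qed.

End PrimeDivisors.

(** * Bounds for blocking by primes beyond the cutoff *)

Section Tail.
Variables (R : realType) (al : R) (b1 b2 : nat).
Hypothesis al01 : 0 < al < 1.
Hypotheses (b1_gt0 : (0 < b1)%N) (b2_gt0 : (0 < b2)%N).
Local Notation T := (walk_op al).
Local Notation c := (smooth_cst al).

Lemma sum_uniq_bounded (F : nat -> R) (s : seq nat) (K : nat) (Q : pred nat) : uniq s ->
  (forall p, p \in s -> Q p -> p < K)%N ->
  \sum_(p <- s | Q p) F p = \sum_(p < K | Q p) ((p : nat) \in s)%:R * F p.
Proof.
move=> s_uniq sK; rewrite -(big_mkord Q (fun p => (p \in s)%:R * F p)).
rewrite [RHS](eq_bigr (fun p => if p \in s then F p else 0)); last first.
  by move=> p _; rewrite mulr_natl mulrb.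
rewrite -big_mkcondr -[LHS]big_filter -[RHS]big_filter /=.
apply: perm_big; apply: uniq_perm; rewrite ?filter_uniq ?iota_uniq //.
move=> p; rewrite !mem_filter mem_index_iota /=.
by case ps : (p \in s); case Qp : (Q p) => //=; rewrite sK.
Qed.

Lemma sum_inv_sqr (M K : nat) : (0 < M)%N ->
  \sum_(p < K | (M <= p)%N) (p%:R ^- 2) <= 2 / M%:R :> R.
Proof.
move=> M0; have MR : 0 < M%:R :> R by rewrite ltr0n.
have [KM|] := leqP K M.
  rewrite big1 ?divr_ge0 ?ler0n // => p Mp.
  by have := leq_trans (leq_ltn_trans Mp (ltn_ord p)) KM; rewrite ltnn.
move=> /ltnW H.
suff : \sum_(p < K | (M <= p)%N) (p%:R ^- 2) <= 2 / M%:R - 2 / K%:R :> R.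
  by move=> h; apply: (le_trans h); rewrite gerBl divr_ge0 ?ler0n.
elim: K H => [|K IH]; first by rewrite leqNgt M0.
rewrite big_mkcond big_ord_recr /= -big_mkcond /= leq_eqVlt => /orP[/eqP ME|].
  rewrite -ME subrr leqNgt ME leqnn addr0 big1 // => p.
  by rewrite ltnNge (ltnW (ltn_ord p)).
rewrite ltnS => MK; rewrite MK /=; apply: (le_trans (lerD (IH MK) (lexx _))).
have K1 : 1 <= K%:R :> R by rewrite ler1n (leq_trans M0).
(* The telescoping step: the right side minus the left is [(K - 1) / (K^2 (K + 1))]. *)
suff : K%:R ^- 2 <= 2 / K%:R - 2 / K.+1%:R :> R.
  by move: (2 / M%:R : R) (2 / K%:R : R) (2 / K.+1%:R : R) (K%:R ^- 2 : R) => *; lra.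
rewrite -natr1 -subr_ge0.
rewrite (_ : _ - _ = (K%:R - 1) / (K%:R ^+ 2 * (K%:R + 1))); last by field; lra.
by rewrite divr_ge0 ?subr_ge0 // mulr_ge0 ?sqr_ge0 //; lra.
Qed.

Definition blocked_from (M : nat) (u y : pt) : bool :=
  `[< exists p, [/\ prime p, (M <= p)%N & blocks_at b1 b2 p y u] >].

Lemma blocks_at_dvd p y u : blocks_at b1 b2 p y u ->
  (p%:Z %| y.1 - u.1)%Z /\ (p%:Z %| (y.1 + y.2) - (u.1 + u.2))%Z.
Proof.
case/andP=> d1 d2.
have d b z : (0 < b)%N -> ((p ^ b)%N%:Z %| z)%Z -> (p%:Z %| z)%Z.
  by move=> b0; apply: dvdz_trans; rewrite dvdzE /= dvdn_exp.
have {}d1 := d _ _ b1_gt0 d1; have {}d2 := d _ _ b2_gt0 d2; split=> //.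
rewrite (_ : _ - _ = (y.1 - u.1) + (y.2 - u.2)); last by ring.
exact: rpredD.
Qed.

(** A union bound over the primes dividing [z], which is determined by the time; [z != 0] makes them
    finitely many. *)
Lemma blocked_from_le (M : nat) (u y : pt) (z : int) :
  z = (y.1 + y.2) - (u.1 + u.2) -> z != 0 ->
  (blocked_from M u y)%:R <= \sum_(p <- primes `|z| | (M <= p)%N) ((p%:Z %| y.1 - u.1)%Z)%:R :> R.
Proof.
move=> zE z0; rewrite /blocked_from; case: asboolP => [[p [p_pr Mp bp]]|_]; last by rewrite sumr_ge0 // => p _; rewrite ler0n.
have [d1 d2] := blocks_at_dvd bp.
have pz : p \in primes `|z|.
  by rewrite mem_primes p_pr absz_gt0 z0 /=; move: d2; rewrite -zE dvdzE.
rewrite -big_filter (bigD1_seq p) ?filter_uniq ?primes_uniq ?mem_filter ?Mp //=.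
by rewrite d1 lerDl sumr_ge0.
Qed.

(** Each prime divisor [p] of [z] costs at most [1 / p] plus the equidistribution error. The term
    [1 / p] is kept for [p <= h] and replaced by [1 / h] for [p > h]; at [z = 0], where every prime
    divides, the trivial bound 1 is used. *)
Lemma walk_op_blocked_from (M m h Om : nat) (u x : pt) (z : int) : (0 < h)%N ->
  z = (x.1 + x.2 + m.+1%:Z) - (u.1 + u.2) ->
  (z != 0 -> size (primes `|z|) <= Om)%N ->
  iter m.+1 T (fun y => (blocked_from M u y)%:R) x <=
  (z == 0)%:R + \sum_(p < h.+1 | (M <= p)%N) ((p%:Z %| z)%Z)%:R / p%:R +
  Om%:R * (h%:R^-1 + c / Num.sqrt m.+2%:R).
Proof.
move=> h0 zE; have c0 := smooth_cst_gt0 al01.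
set S := \sum_(p < h.+1 | _) _.
have S0 : 0 <= S by apply: sumr_ge0 => p _; rewrite divr_ge0.
set e := h%:R^-1 + _.
have e0 : 0 <= e by rewrite addr_ge0 ?divr_ge0 ?invr_ge0 ?ler0n ?sqrtr_ge0 ?ltW.
have [zz _|z0 /(_ isT) sz] := eqVneq z 0.
  apply: (@le_trans _ _ 1); last by rewrite -addrA lerDl addr_ge0 ?mulr_ge0.
  by apply: walk_op_le1 => // y; case: blocked_from.
rewrite add0r.
apply: (@le_trans _ _ (iter m.+1 T (fun y => \sum_(p <- primes `|z| | (M <= p)%N) ((p%:Z %| y.1 - u.1)%Z)%:R) x)).
  by apply: le_iter_walk_op_on => // y yE; apply: blocked_from_le => //; rewrite yE.
rewrite iter_walk_op_sum //.
apply: (@le_trans _ _ (\sum_(p <- primes `|z| | (M <= p)%N) ((p <= h)%N%:R / p%:R + e))).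
  rewrite big_seq_cond [leRHS]big_seq_cond; apply: ler_sum => p /andP[].
  rewrite mem_primes => /and3P[p_pr _ _] _; have p0 := prime_gt0 p_pr.
  have := walk_op_residue al01 u.1 m.+1 x p0; rewrite ler_norml => /andP[_].
  rewrite lerBlDr => H; apply: (le_trans H); rewrite addrC /e addrA lerD2r.
  have [ph|hp] := leqP p h; first by rewrite mul1r lerDl invr_ge0 ler0n.
  by rewrite mul0r add0r lef_pV2 ?posrE ?ltr0n // ler_nat ltnW.
rewrite big_split /= lerD //.
  rewrite [leLHS](eq_bigr (fun p => if (p <= h)%N then p%:R^-1 else 0)); last first.
    by move=> p _; rewrite mulr_natl mulrb.
  rewrite -big_mkcondr /= (@sum_uniq_bounded _ _ h.+1) ?primes_uniq //; last first.
    by move=> p _ /andP[_]; rewrite ltnS.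
  rewrite /S big_mkcond [leRHS]big_mkcond; apply: ler_sum => p _.
  have ph : (p <= h)%N by rewrite -ltnS ltn_ord.
  rewrite ph andbT; case: leqP => // _.
  apply: ler_wpM2r; first by rewrite invr_ge0.
  rewrite ler_nat mem_primes dvdzE /=.
  by case: (prime p) => //=; case: (0 < `|z|)%N => //=.
rewrite big_const_seq iter_addr_0 -[leLHS]mulr_natl ler_wpM2r // ler_nat.
exact: leq_trans (count_size _ _) sz.
Qed.

(** Over the block [z] runs through [h] consecutive integers. It vanishes at most once, and each
    [p <= h] divides at most [h / p + 1 <= 2 h / p] of its values, so the sum over [p >= M] is at
    most [4 h / M]. *)
Lemma sum_walk_op_blocked_from (M h Om : nat) (u x : pt) : (0 < h)%N -> (0 < M)%N ->
  (forall m : nat, (m < h)%N -> let z := (x.1 + x.2 + m.+1%:Z) - (u.1 + u.2) in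
     z != 0 -> (size (primes `|z|) <= Om)%N) ->
  \sum_(m < h) iter m.+1 T (fun y => (blocked_from M u y)%:R) x <=
  1 + 4 * h%:R / M%:R + Om%:R * (1 + 2 * c * Num.sqrt h%:R).
Proof.
move=> h0 M0 HOm; have hR : 0 < h%:R :> R by rewrite ltr0n.
set z0 : int := x.1 + x.2 + 1 - (u.1 + u.2).
pose z (m : nat) : int := z0 + m%:Z.
have zE m : z m = (x.1 + x.2 + m.+1%:Z) - (u.1 + u.2) by rewrite /z /z0 intS; ring.
apply: (@le_trans _ _ (\sum_(m < h) ((z m == 0)%:R +
    \sum_(p < h.+1 | (M <= p)%N) ((p%:Z %| z m)%Z)%:R / p%:R +
    Om%:R * (h%:R^-1 + c / Num.sqrt m.+2%:R)))).
  apply: ler_sum => m _; apply: walk_op_blocked_from => //.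
  by rewrite zE; apply: HOm.
rewrite !big_split /= lerD //; first rewrite lerD //.
- rewrite -[leRHS](@sum_dvdz_window_sym R h (- z0) h0); apply: ler_sum => m _.
  rewrite ler_nat /z opprK addrC; case: eqP => // ->; by rewrite dvdz0.
- rewrite exchange_big /=.
  apply: (@le_trans _ _ (\sum_(p < h.+1 | (M <= p)%N) 2 * h%:R * p%:R ^- 2)).
    apply: ler_sum => p Mp; have p0 : (0 < p)%N by apply: leq_trans Mp.
    rewrite -mulr_suml expr2 invfM mulrA; apply: ler_wpM2r; first by rewrite invr_ge0.
    have := @periodic_sum_le R p (fun x => ((p%:Z %| x)%Z)%:R) z0 h p0.
    have -> : \sum_(i < p) ((p%:Z %| i%:Z)%Z)%:R = 1 :> R.
      rewrite -[RHS](@sum_dvdz_window_sym R p 0 p0); apply: eq_bigr => i _.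
      by rewrite subr0.
    rewrite mulr1 => H; apply: (le_trans (H _ _)).
    - by move=> y; rewrite ler0n.
    - by move=> y; rewrite rpredDr ?dvdzz.
    rewrite ler_pdivlMr ?ltr0n // -!natrM ler_nat mulSn.
    by rewrite mul2n -addnn leq_add // ?leq_divM // -ltnS ltn_ord.
  rewrite -mulr_sumr.
  have := sum_inv_sqr h.+1 M0; move=> /(ler_wpM2l (_ : 0 <= 2 * h%:R)) H.
  by apply: (le_trans (H _)); [rewrite mulr_ge0 ?ler0n|rewrite le_eqVlt; apply/orP; left; apply/eqP; ring].
- rewrite -mulr_sumr; apply: ler_wpM2l; first by rewrite ler0n.
  rewrite big_split /= lerD // ?sum_smooth_bound //.
  by rewrite sumr_const card_ord -[leLHS]mulr_natl mulfV // gt_eqF.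
Qed.
End Tail.

(** * Uniform density of visible points *)

Section UniformDensity.
Variables (R : realType) (al : R) (b1 b2 : nat) (W : seq pt).
Hypothesis al01 : 0 < al < 1.
Hypotheses (b1_gt0 : (0 < b1)%N) (b2_gt0 : (0 < b2)%N) (b_coprime : coprime b1 b2).
Hypotheses (W_uniq : uniq W) (W_star : condition_star b1 b2 W).
Local Notation T := (walk_op al).
Local Notation c := (smooth_cst al).
Local Notation L := (prime_partial_prod R (size W) (b1 + b2)).

Definition visible_from_all (x : pt) : bool :=
  `[< forall u, u \in W -> bvisible b1 b2 x u >].

(** Visibility from all of [W] forces the truncated indicator to be 1. If it fails at some [u], then
    [y] lies on a line through [u], or a prime at least [M] blocks, or a smaller prime blocks and
    the truncated indicator is 0. *)
Lemma visible_trunc_dist (M : nat) (y : pt) :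
  `|(visible_from_all y)%:R - trunc_visible R b1 b2 W M y| <=
  \sum_(u <- W) ((blocked_from b1 b2 M u y)%:R + (y.1 == u.1)%:R + (y.2 == u.2)%:R) :> R.
Proof.
pose F (u : pt) : R := (blocked_from b1 b2 M u y)%:R + (y.1 == u.1)%:R + (y.2 == u.2)%:R.
rewrite -[leRHS]/(\sum_(u <- W) F u); have F0 u : 0 <= F u by rewrite !addr_ge0.
rewrite /visible_from_all; case: asboolP => [vis|/existsNP[u /not_implyP[uW nvis]]].
  rewrite [trunc_visible _ _ _ _ _ _]big1 ?subrr ?normr0 ?sumr_ge0 // => p p_pr.
  rewrite /unblocked_at (_ : all _ _ = true) //; apply/allP => u uW.
  by apply: bvisible_not_blocked => //; exact: vis.
have F_le u' : u' \in W -> 1 <= F u' -> 1 <= \sum_(v <- W) F v.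
  move=> u'W H; rewrite (bigD1_seq u') //= (le_trans H) // lerDl sumr_ge0 //.
have /andP[t0 t1] := trunc_visible01 R b1 b2 W M y.
rewrite sub0r normrN ger0_norm //.
have [E1|N1] := eqVneq y.1 u.1.
  apply: (le_trans t1); apply: (F_le u) => //.
  by rewrite /F E1 eqxx addrAC lerDr addr_ge0.
have [E2|N2] := eqVneq y.2 u.2.
  apply: (le_trans t1); apply: (F_le u) => //.
  by rewrite /F E2 eqxx lerDr addr_ge0.
have [p p_pr bp] : exists2 p, prime p & blocks_at b1 b2 p y u.
  apply: contrapT => H; apply: nvis; apply: unblocked_bvisible => // p p_pr.
  by apply/negP => bp; apply: H; exists p.
have [Mp|pM] := leqP M p.
  apply: (le_trans t1); apply: (F_le u) => //.
  rewrite /F (_ : blocked_from _ _ _ _ _ = true); first by rewrite -addrA lerDl addr_ge0.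
  by apply/asboolP; exists p.
rewrite /trunc_visible (bigD1 (Ordinal pM)) //= [unblocked_at _ _ _ _ _ _](_ : _ = 0).
  by rewrite mul0r sumr_ge0.
rewrite /unblocked_at (_ : all _ _ = false) //.
by apply/negbTE/allPn; exists u => //; rewrite negbK.
Qed.

Lemma sqrt_natX4 (k : nat) : Num.sqrt (k ^ 4)%:R = k%:R ^+ 2 :> R.
Proof. by rewrite natrX (exprM _ 2 2) sqrtr_sqr ger0_norm // sqr_ge0. Qed.

(** The target may move with time: the horizontal line through [u] is the condition that [y.1]
    equals [x.1 + x.2 + m.+1 - u.2]. *)
Lemma sum_walk_op_point (a : nat -> int) (h : nat) (x : pt) :
  \sum_(m < h) iter m.+1 T (fun y => (y.1 == a m)%:R) x <= 2 * c * Num.sqrt h%:R.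
Proof.
apply: le_trans (sum_smooth_bound al01 h); apply: ler_sum => m _.
exact: walk_op_point.
Qed.

Lemma sum_walk_op_lines (u x : pt) (h : nat) :
  \sum_(m < h) iter m.+1 T (fun y => (y.1 == u.1)%:R + (y.2 == u.2)%:R) x <=
  4 * c * Num.sqrt h%:R.
Proof.
under eq_bigr => m _ do rewrite iter_walk_opD.
rewrite big_split /= (_ : 4 * c * _ = 2 * c * Num.sqrt h%:R + 2 * c * Num.sqrt h%:R); last by ring.
rewrite lerD //; first exact: (sum_walk_op_point (fun=> u.1)).
apply: le_trans (sum_walk_op_point (fun m => x.1 + x.2 + m.+1%:Z - u.2) h x).
rewrite le_eqVlt; apply/orP; left; apply/eqP; apply: eq_bigr => m _.
apply: (@eq_iter_walk_op_on _ _ al01 m.+1) => y yE; rewrite -yE; congr (_%:R); congr nat_of_bool.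
by rewrite -addrA -{1}[y.1]addr0 (inj_eq (addrI _)) [RHS]eq_sym subr_eq0.
Qed.

Lemma sum_walk_op_blocked_poly (M : nat) (u : pt) : (0 < M)%N ->
  exists2 D : R, 0 <= D & forall (k t : nat) (x : pt), (0 < k)%N -> (t <= k ^ 8)%N ->
  x.1 + x.2 = t%:Z ->
  \sum_(m < k ^ 4) iter m.+1 T (fun y => (blocked_from b1 b2 M u y)%:R) x <=
  4 * (k ^ 4)%:R / M%:R + D * k%:R ^+ 3.
Proof.
move=> M0; have c0 := smooth_cst_gt0 al01.
(* With this [K] every [z] in the block satisfies [|z| <= K k^8 <= (K k)^8]: the 2 accounts for the
   starting time and for the block length. *)
pose K := (2 + absz (u.1 + u.2)%R)%N.
(* The 1 comes from the zero of [z]; then at most [8 (K + 1) k] prime factors, each costing at most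
   [(1 + 2 c) k^2]. *)
exists (1 + 8 * (K%:R + 1) * (1 + 2 * c)).
  by rewrite addr_ge0 // !mulr_ge0 // addr_ge0 ?mulr_ge0 ?ltW.
move=> k t x k0 tk xE; have k1 : 1 <= k%:R :> R by rewrite ler1n.
have h0 : (0 < k ^ 4)%N by rewrite expn_gt0 k0.
apply: (le_trans (@sum_walk_op_blocked_from R al b1 b2 al01 b1_gt0 b2_gt0 M (k ^ 4) (8 * (K * k).+1) u x h0 M0 _)).
  move=> m mk z z0; apply: size_primes_bound; rewrite ?absz_gt0 //.
  have H1 : (`|z| <= t + m.+1 + absz (u.1 + u.2)%R)%N by rewrite /z xE; clear; lia.
  apply: (leq_trans H1); apply: (@leq_trans (K * k ^ 8)%N); last first.
    by rewrite expnMn leq_mul2r -{1}(expn1 K) leq_pexp2l ?orbT // /K addn_gt0.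
  have H2 : (m.+1 <= k ^ 8)%N by apply: (leq_trans mk); rewrite leq_pexp2l.
  have H3 : (absz (u.1 + u.2)%R <= absz (u.1 + u.2)%R * k ^ 8)%N by rewrite leq_pmulr // expn_gt0 k0.
  rewrite /K mulnDl; clear -tk H2 H3; lia.
rewrite sqrt_natX4 natrM -[(K * k).+1%:R]natr1 natrM.
set A := 4 * _ / _; set KR := K%:R; set kk := k%:R; rewrite -/kk in k1.
have KR0 : 0 <= KR :> R by rewrite ler0n.
have k3 : 1 <= kk ^+ 3 by rewrite exprn_ege1.
have e1 : KR * kk + 1 <= (KR + 1) * kk by lra.
have e2 : 1 + 2 * c * kk ^+ 2 <= (1 + 2 * c) * kk ^+ 2.
  by have : 1 <= kk ^+ 2 by [rewrite exprn_ege1|]; lra.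
have e3 : (KR * kk + 1) * (1 + 2 * c * kk ^+ 2) <= ((KR + 1) * kk) * ((1 + 2 * c) * kk ^+ 2).
  by apply: ler_pM => //; rewrite addr_ge0 ?mulr_ge0 ?sqr_ge0 ?ltW //; lra.
have e4 : ((KR + 1) * kk) * ((1 + 2 * c) * kk ^+ 2) = (KR + 1) * (1 + 2 * c) * kk ^+ 3 by ring.
by rewrite e4 in e3; lra.
Qed.

(* The error has order [k^3] because the smoothing bound sums to [O(sqrt h) = O(k^2)] over a
   block of length [h = k^4] and the integers up to [k^8] have [O(k)] prime factors. *)
Lemma walk_op_visible_density (M : nat) : (0 < M)%N ->
  exists2 D : R, 0 <= D & forall (k t : nat) (x : pt), (0 < k)%N -> (t <= k ^ 8)%N ->
  x.1 + x.2 = t%:Z ->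
  `|\sum_(m < k ^ 4) iter m.+1 T (fun y => (visible_from_all y)%:R) x - (k ^ 4)%:R * L M| <=
  (size W)%:R * (4 * (k ^ 4)%:R / M%:R) + D * k%:R ^+ 3.
Proof.
move=> M0; have c0 := smooth_cst_gt0 al01.
have [D D0 HD] : exists2 D : R, 0 <= D & forall (k t : nat) (x : pt), (0 < k)%N -> (t <= k ^ 8)%N ->
    x.1 + x.2 = t%:Z ->
    \sum_(u <- W) \sum_(m < k ^ 4) iter m.+1 T (fun y => (blocked_from b1 b2 M u y)%:R +
       ((y.1 == u.1)%:R + (y.2 == u.2)%:R)) x <=
    (size W)%:R * (4 * (k ^ 4)%:R / M%:R) + D * k%:R ^+ 3.
  (* Induction on the list adds up the constants belonging to the individual points. *)
  elim: (W) => [|u s [D D0 IH]].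
    by exists 0 => // k t x _ _ _; rewrite big_nil mulr0n !mul0r addr0.
  have [D' D'0 H'] := sum_walk_op_blocked_poly u M0.
  exists (D' + 4 * c + D); first by rewrite !addr_ge0 // mulr_ge0 // ltW.
  move=> k t x k0 tk xE; rewrite big_cons.
  have {}IH := IH k t x k0 tk xE; have {}H' := H' k t x k0 tk xE.
  have H2 := sum_walk_op_lines u x (k ^ 4); rewrite sqrt_natX4 in H2.
  under [X in X + _]eq_bigr => m _ do rewrite iter_walk_opD.
  rewrite big_split /=.
  have k23 : 4 * c * k%:R ^+ 2 <= 4 * c * k%:R ^+ 3.
    have c4 : 0 <= 4 * c by rewrite mulr_ge0 // ltW.
    by apply: (ler_wpM2l c4); rewrite ler_weXn2l // ler1n.
  rewrite -natr1 mulrDl mul1r !mulrDl.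
  apply: (le_trans (lerD (lerD H' (le_trans H2 k23)) IH)).
  by rewrite le_eqVlt; apply/orP; left; apply/eqP; ring.
have [[per1 per2] mean] := mean2_trunc_visible R b1_gt0 b2_gt0 W_uniq W_star M.
set q := trunc_period b1 b2 M in per1 per2 mean.
have q0 : (0 < q)%N := trunc_period_gt0 b1 b2 M.
(* [D] bounds the distance to the truncated indicator; the second term is the periodic averaging
   error [q + 2 c q k^2]. *)
exists (D + q%:R * (1 + 2 * c)).
  by rewrite addr_ge0 ?mulr_ge0 // addr_ge0 ?mulr_ge0 ?ltW.
move=> k t x k0 tk xE; have {}HD := HD k t x k0 tk xE.
have k1 : 1 <= k%:R :> R by rewrite ler1n.
set V := \sum_(m < _) _; pose G := \sum_(m < k ^ 4) iter m.+1 T (trunc_visible R b1 b2 W M) x.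
have HG := walk_op_periodic al01 (k ^ 4) x q0 (trunc_visible01 R b1 b2 W M) per1 per2.
rewrite -/(mean2 q _) mean sqrt_natX4 -/G in HG.
have HV : `|V - G| <= (size W)%:R * (4 * (k ^ 4)%:R / M%:R) + D * k%:R ^+ 3.
  apply: le_trans HD; rewrite /V /G -sumrB (le_trans (ler_norm_sum _ _ _)) //.
  rewrite [leRHS]exchange_big; apply: ler_sum => m _.
  rewrite -iter_walk_opB -iter_walk_op_sum // (le_trans (norm_iter_walk_op _ _ _ _)) //.
  apply: le_iter_walk_op_on => // y _; apply: (le_trans (visible_trunc_dist M y)).
  by apply: ler_sum => u _; rewrite addrA.
rewrite (_ : _ - _ = (V - G) + (G - (k ^ 4)%:R * L M)); last by ring.
apply: (le_trans (ler_normD _ _)).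
rewrite [(D + _) * _]mulrDl [leRHS]addrA; apply: (lerD HV); apply: (le_trans HG).
have q1 : 0 <= q%:R :> R by rewrite ler0n.
rewrite [leLHS](_ : _ = q%:R * (1 + 2 * c * k%:R ^+ 2)); last by ring.
rewrite -[leRHS]mulrA; apply: (ler_wpM2l q1); rewrite [leRHS]mulrDl mul1r.
have c2 : 0 <= 2 * c by rewrite mulr_ge0 // ltW.
by rewrite lerD ?exprn_ege1 //; apply: (ler_wpM2l c2); rewrite ler_weXn2l.
Qed.
End UniformDensity.

(** * Block martingale over finite words *)

Section Words.
Variables (R : realType) (al : R).
Hypothesis al01 : 0 < al < 1.
Local Notation T := (walk_op al).

(** The last letter is peeled off, in accordance with the growth of the past, whereas [walk_op]
    peels off the first step; [word_expect_cat] reconciles the two. *)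
Fixpoint word_expect (n : nat) (F : seq bool -> R) : R :=
  if n is n'.+1 then
    al * word_expect n' (fun s => F (rcons s true)) +
    (1 - al) * word_expect n' (fun s => F (rcons s false))
  else F [::].
Local Notation Ex := word_expect.

Lemma le_word_expect n F G : (forall s, size s = n -> F s <= G s) -> Ex n F <= Ex n G.
Proof.
case/andP: al01 => a0 a1; elim: n F G => [|n IH] F G H /=; first exact: H.
have b0 : 0 <= 1 - al by lra.
rewrite lerD //; [apply: (ler_wpM2l (ltW a0))|apply: (ler_wpM2l b0)];
  by apply: IH => s sn; apply: H; rewrite size_rcons sn.
Qed.

Lemma eq_word_expect n F G : (forall s, size s = n -> F s = G s) -> Ex n F = Ex n G.
Proof.
move=> H; apply/eqP; rewrite eq_le; apply/andP; split;
  by apply: le_word_expect => s /H ->.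
Qed.

Lemma word_expect_cst n k : Ex n (fun=> k) = k.
Proof. by elim: n => //= n ->; ring. Qed.

Lemma word_expectD n F G : Ex n (fun s => F s + G s) = Ex n F + Ex n G.
Proof. by elim: n F G => //= n IH F G; rewrite !IH; ring. Qed.

Lemma word_expectZ n k F : Ex n (fun s => k * F s) = k * Ex n F.
Proof. by elim: n F => //= n IH F; rewrite !IH; ring. Qed.

Lemma word_expect_sum (I : Type) (r : seq I) n (F : I -> seq bool -> R) :
  Ex n (fun s => \sum_(i <- r) F i s) = \sum_(i <- r) Ex n (F i).
Proof.
elim: r => [|i r IH].
  rewrite big_nil -[RHS](word_expect_cst n 0).
  by apply: eq_word_expect => s _; rewrite big_nil.
rewrite big_cons -IH -word_expectD.
by apply: eq_word_expect => s _; rewrite big_cons.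
Qed.

Lemma word_expect_cat m n F : Ex (m + n) F = Ex m (fun s => Ex n (fun t => F (s ++ t))).
Proof.
elim: n F => [|n IH] F.
  by rewrite addn0; apply: eq_word_expect => s _; rewrite /= cats0.
rewrite addnS /= !IH -!word_expectZ -word_expectD; apply: eq_word_expect => s _ /=.
by congr (_ * _ + _ * _); apply: eq_word_expect => t _; rewrite rcons_cat.
Qed.

Lemma word_expect_take m n F : (m <= n)%N -> Ex n (fun s => F (take m s)) = Ex m F.
Proof.
move=> mn; rewrite -(subnKC mn) word_expect_cat; apply: eq_word_expect => s sm.
rewrite -[RHS](word_expect_cst (n - m) (F s)); apply: eq_word_expect => t _.
by rewrite take_size_cat.
Qed.

Definition walk_end (x : pt) (s : seq bool) : pt :=
  (x.1 + (count id s)%:Z, x.2 + (count negb s)%:Z).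

Lemma walk_end_cat x s t : walk_end x (s ++ t) = walk_end (walk_end x s) t.
Proof. by rewrite /walk_end !count_cat !PoszD !addrA. Qed.

Lemma word_expect_walk_end m g x : Ex m (fun s => g (walk_end x s)) = iter m T g x.
Proof.
elim: m x => [|m IH] x; first by rewrite /= /walk_end /= !addr0; case: x.
rewrite iter_walk_opS -!IH -add1n word_expect_cat /=; congr (_ * _ + _ * _);
  by apply: eq_word_expect => t _; congr g; rewrite /walk_end /= ?PoszD ?addrA ?add0n.
Qed.

(** * Block deviations as martingale increments, and Chebyshev's inequality *)

Section BlockMartingale.
Variables (g : pt -> R) (h : nat).
Hypothesis g01 : forall x, 0 <= g x <= 1.

Definition pos_at (i : nat) (s : seq bool) : pt := walk_end (0, 0) (take i s).

Definition block_dev (k : nat) (s : seq bool) : R :=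
  \sum_(m < h) (g (pos_at (k * h + m.+1) s) - iter m.+1 T g (pos_at (k * h) s)).

Definition block_mart (N : nat) (s : seq bool) : R := \sum_(k < N) block_dev k s.

Lemma pos_at_cat i s t : (i <= size s)%N -> pos_at i (s ++ t) = pos_at i s.
Proof. by move=> si; rewrite /pos_at takel_cat. Qed.

Lemma pos_at_catr i s t : pos_at (size s + i) (s ++ t) = walk_end (walk_end (0, 0) s) (take i t).
Proof. by rewrite /pos_at takeD take_size_cat // drop_size_cat // walk_end_cat. Qed.

Lemma block_mart_cat N s t : size s = (N * h)%N -> block_mart N (s ++ t) = block_mart N s.
Proof.
move=> sN; apply: eq_bigr => k _; apply: eq_bigr => m _.
have H1 : (k * h + m.+1 <= size s)%N.
  rewrite sN; apply: (@leq_trans (k.+1 * h)); last by rewrite leq_mul2r ltn_ord orbT.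
  by rewrite mulSn addnC leq_add2r ltn_ord.
by rewrite !pos_at_cat // (leq_trans _ H1) // leq_addr.
Qed.

Lemma norm_block_dev k s : `|block_dev k s| <= h%:R.
Proof.
apply: (le_trans (ler_norm_sum _ _ _)).
apply: (@le_trans _ _ (\sum_(m < h) 1)); last by rewrite sumr_const card_ord.
apply: ler_sum => m _.
have /andP[g0 g1] := g01 (pos_at (k * h + m.+1) s).
have t0 : 0 <= iter m.+1 T g (pos_at (k * h) s).
  by apply: walk_op_ge0 => // y; case/andP: (g01 y).
have t1 : iter m.+1 T g (pos_at (k * h) s) <= 1.
  by apply: walk_op_le1 => // y; case/andP: (g01 y).
rewrite ler_norml; apply/andP; split; lra.
Qed.

(** The martingale property: given the past [s], the future depends only on the endpoint, and the
    subtracted iterate is the conditional mean. *)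
Lemma block_dev_centered N s : size s = (N * h)%N ->
  Ex h (fun t => block_dev N (s ++ t)) = 0.
Proof.
move=> sN; rewrite word_expect_sum big1 // => m _; rewrite -sN.
rewrite (@eq_word_expect _ _ (fun t => g (walk_end (walk_end (0, 0) s) (take m.+1 t)) +
   (-1) * iter m.+1 T g (walk_end (0, 0) s))); last first.
  by move=> t _; rewrite pos_at_catr -[size s]addn0 pos_at_catr take0 mulN1r /walk_end /= !addr0.
rewrite word_expectD word_expect_cst.
rewrite (@word_expect_take _ _ (fun t => g (walk_end _ t))) ?ltn_ord //.
by rewrite word_expect_walk_end mulN1r subrr.
Qed.

(** Orthogonality of increments: the cross term has mean zero given the past, and each squared
    increment is at most [h^2]. *)
Lemma block_mart_second_moment N :
  Ex (N * h) (fun s => block_mart N s ^+ 2) <= N%:R * h%:R ^+ 2.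
Proof.
elim: N => [|N IH]; first by rewrite mul0n /= /block_mart big_ord0 expr0n mul0r.
rewrite mulSn addnC word_expect_cat -natr1 mulrDl mul1r.
apply: (@le_trans _ _ (Ex (N * h) (fun s => block_mart N s ^+ 2 + h%:R ^+ 2))); last first.
  by rewrite word_expectD word_expect_cst lerD2r.
apply: le_word_expect => s sN.
rewrite (@eq_word_expect _ _ (fun t => block_mart N s ^+ 2 +
   (2 * block_mart N s * block_dev N (s ++ t) + block_dev N (s ++ t) ^+ 2))); last first.
  move=> t _; rewrite /block_mart big_ord_recr /= -!/(block_mart _ _) block_mart_cat //; ring.
rewrite word_expectD word_expect_cst lerD2l word_expectD word_expectZ block_dev_centered //.
rewrite mulr0 add0r -[leRHS](word_expect_cst h); apply: le_word_expect => t _.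
by rewrite -[leLHS]real_normK ?num_real // ler_sqr ?nnegrE ?norm_block_dev.
Qed.

Lemma block_mart_deviation N (d : R) : 0 < d ->
  Ex (N * h) (fun s => (d < `|block_mart N s|)%R%:R) <= N%:R * h%:R ^+ 2 / d ^+ 2.
Proof.
move=> d0; rewrite mulrC.
apply: (@le_trans _ _ (Ex (N * h) (fun s => d ^- 2 * block_mart N s ^+ 2))).
  apply: le_word_expect => s _; case: ltP => [dM|_] /=; last first.
    by rewrite mulr_ge0 ?invr_ge0 ?sqr_ge0.
  rewrite mulrC ler_pdivlMr ?exprn_gt0 // mul1r -[leRHS]real_normK ?num_real //.
  by rewrite ler_sqr ?nnegrE ?normr_ge0 ?ltW.
rewrite word_expectZ; apply: ler_wpM2l; last exact: block_mart_second_moment.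
by rewrite invr_ge0 sqr_ge0.
Qed.
End BlockMartingale.
End Words.

(** * Law of the walk *)

Section WalkLaw.
Variables (d : measure_display) (T : measurableType d) (R : realType).
Variables (P : probability T R) (al : R) (E : nat -> set T).
Hypotheses (E_meas : forall i, measurable (E i)) (E_prob : forall i, P (E i) = al%:E).
Hypothesis E_indep : mutually_independent P E.

Definition step_word (n : nat) (w : T) : seq bool := mkseq (fun i => `[< E i w >]) n.

Lemma step_word_eventS n (B : pred (seq bool)) :
  [set w | B (step_word n.+1 w)] =
  ([set w | B (rcons (step_word n w) true)] `&` E n) `|`
  ([set w | B (rcons (step_word n w) false)] `\` E n).
Proof.
apply/seteqP; split => w /=; rewrite /step_word mkseqS; case: asboolP => Ew.
- by left.
- by right.
- by case=> -[].
- by case=> -[].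
Qed.

Lemma measurable_step_word n (B : pred (seq bool)) : measurable [set w | B (step_word n w)].
Proof.
elim: n B => [|n IH] B.
  rewrite /step_word /mkseq /=; case: (B [::]).
    by rewrite (_ : [set _ | _] = setT); [exact: measurableT|apply/seteqP; split=> w].
  by rewrite (_ : [set _ | _] = set0); [exact: measurable0|apply/seteqP; split=> w].
rewrite step_word_eventS; apply: measurableU.
  by apply: measurableI => //; exact: (IH (fun t => B (rcons t true))).
by apply: measurableD => //; exact: (IH (fun t => B (rcons t false))).
Qed.

Lemma bigcap_cons i (s : seq nat) :
  \bigcap_(j in [set` i :: s]) E j = \bigcap_(j in [set` s]) E j `&` E i.
Proof.
apply/seteqP; split => w /=.
  move=> H; split; last by apply: (H i); rewrite /= inE eqxx.
  by move=> j js; apply: (H j); rewrite /= inE js orbT.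
by move=> [H Ei] j; rewrite /= inE => /orP[/eqP ->|/H].
Qed.

(** Independence is given for intersections of the [E i] but not of their complements. Carrying a
    set [s] of future events through the induction allows a complement to be handled as
    [P (A) - P (A & E n)]. *)
Lemma prob_step_word_future n (B : pred (seq bool)) (s : seq nat) :
  uniq s -> (forall i, i \in s -> n <= i)%N ->
  P ([set w | B (step_word n w)] `&` \bigcap_(i in [set` s]) E i) =
  (word_expect al n (fun t => (B t)%:R) * al ^+ size s)%:E.
Proof.
elim: n B s => [|n IH] B s s_uniq sn.
  have PE : P (\bigcap_(i in [set` s]) E i) = (al ^+ size s)%:E.
    rewrite E_indep //; elim: (s) => [|i s' IHs]; first by rewrite big_nil.
    by rewrite big_cons IHs E_prob /= exprS EFinM.
  rewrite /step_word /mkseq /=; case: (B [::]).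
    by rewrite (_ : [set _ | _] = setT) ?setTI ?mul1r //; apply/seteqP; split=> w.
  by rewrite (_ : [set _ | _] = set0) ?set0I ?measure0 ?mul0r //; apply/seteqP; split=> w.
set F := \bigcap_(i in _) _.
have mF : measurable F by apply: fin_bigcap_measurable => //; exact: finite_seq.
have mB := measurable_step_word n.
have ns_uniq : uniq (n :: s).
  by rewrite /= s_uniq andbT; apply/negP => /sn; rewrite ltnn.
have sn' i : i \in n :: s -> (n <= i)%N by rewrite inE => /orP[/eqP ->|/sn /ltnW].
have sn'' i : i \in s -> (n <= i)%N by move=> /sn /ltnW.
rewrite step_word_eventS setIUl.
set At := [set w | B (rcons _ true)]; set Af := [set w | B (rcons _ false)].
have mAt : measurable At by exact: (mB (fun t => B (rcons t true))).
have mAf : measurable Af by exact: (mB (fun t => B (rcons t false))).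
have -> : At `&` E n `&` F = At `&` (F `&` E n) by rewrite -setIA (setIC F).
have -> : (Af `\` E n) `&` F = (Af `&` F) `\` E n by rewrite !setDE setIAC.
rewrite measureU //; first last.
- by apply/seteqP; split => w //= [[_ [_ ?]] []].
- by apply: measurableD => //; exact: measurableI.
- by apply: measurableI => //; exact: measurableI.
have mAfF : measurable (Af `&` F) by exact: measurableI.
rewrite [X in (_ + X)%E](@measureD _ _ _ P) //; last first.
  by rewrite (le_lt_trans (probability_le1 P mAfF)) ?ltry.
have FE : F `&` E n = \bigcap_(i in [set` n :: s]) E i by rewrite bigcap_cons.
rewrite -setIA FE.
have H1 := IH (fun t => B (rcons t true)) (n :: s) ns_uniq sn'.
have H2 := IH (fun t => B (rcons t false)) (n :: s) ns_uniq sn'.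
have H3 := IH (fun t => B (rcons t false)) s s_uniq sn''.
rewrite -/At in H1; rewrite -/Af in H2 H3.
rewrite [X in (X + _)%E]H1 [X in (_ + (_ - X))%E]H2 [X in (_ + (X - _))%E]H3 -EFinB -EFinD; congr (_%:E).
by rewrite /= exprS; ring.
Qed.

Lemma prob_step_word n (B : pred (seq bool)) :
  P [set w | B (step_word n w)] = (word_expect al n (fun t => (B t)%:R))%:E.
Proof.
have := @prob_step_word_future n B [::] isT; rewrite /= mulr1 => <- //.
by rewrite (_ : \bigcap_(i in _) _ = setT) ?setIT //; apply/seteqP; split=> w.
Qed.

Lemma pos_at_step_word i n w : (i <= n)%N -> pos_at i (step_word n w) = walk_pos E i w.
Proof.
move=> le_in; rewrite /pos_at /step_word /mkseq -map_take take_iota (minn_idPl le_in).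
rewrite /walk_end /walk_pos /= !add0r.
have kE : count id [seq `[< E j w >] | j <- iota 0 i] = (\sum_(j < i) (`[< E j w >] : nat))%N.
  by rewrite -sumn_count sumnE -map_comp big_map -(big_mkord xpredT (fun j => (`[< E j w >] : nat))) /index_iota subn0.
rewrite kE; congr (_, Posz _); rewrite -kE.
have := count_predC id [seq `[< E j w >] | j <- iota 0 i].
rewrite size_map size_iota (@eq_count _ (predC id) negb) // => H.
by apply: (@addnI (count id [seq `[< E j w >] | j <- iota 0 i])); rewrite H subnKC // -{2}H leq_addr.
Qed.

Lemma borel_cantelli_sqr (F : nat -> set T) : (forall k, measurable (F k)) ->
  (forall k, P (F k) <= (k.+1%:R ^- 2)%:E)%E ->
  {ae P, forall w, \forall k \near \oo, ~ F k w}.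
Proof.
move=> mF PF; exists (lim_sup_set F); split.
- by apply: bigcapT_measurable => n; apply: bigcup_measurable.
- apply: lim_sup_set_cvg0 => //; apply: (@le_lt_trans _ _ 2%:E); last by rewrite ltry.
  apply: lime_le; first by apply: is_cvg_nneseries.
  apply: nearW => n.
  apply: (@le_trans _ _ (\sum_(0 <= i < n) (i.+1%:R ^- 2)%:E)%E); first by apply: lee_sum => i _; exact: PF.
  rewrite sumEFin lee_fin.
  have := @sum_inv_sqr R 1 n.+1 isT; rewrite divr1; apply: le_trans.
  (* The index 0 is excluded by the condition [1 <= p], which aligns the sum with the shifted
     terms. *)
  rewrite [leRHS]big_mkcond big_ord_recl /= add0r big_mkord.
  by apply: ler_sum.
- move=> w; apply: contra_notP => /existsNP[n /not_implyP[_ H]].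
  by exists n => // k nk Fk; apply: H; exists k.
Qed.
End WalkLaw.

(** * From the times [k^8] to all times *)

Section Averages.
Variable R : realType.

Lemma sum_nat_blocks (F : nat -> R) (N h : nat) :
  \sum_(1 <= i < (N * h).+1) F i = \sum_(j < N) \sum_(m < h) F (j * h + m.+1)%N.
Proof.
rewrite big_add1 /=; elim: N => [|N IH]; first by rewrite mul0n big_geq // big_ord0.
rewrite big_ord_recr /= -IH mulSn addnC !big_mkord big_split_ord /=; congr (_ + _).
by apply: eq_bigr => m _; rewrite addnS.
Qed.

(** Repeated squaring; the constants 3, 15, 255 are the [2^j - 1] that give equality at [x = 1]. *)
Lemma succ_exp8_le (x : R) : 1 <= x -> (x + 1) ^+ 8 <= x ^+ 8 + 255 * x ^+ 7.
Proof.
move=> x1; have x0 : 0 <= x by lra.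
have H1 : (x + 1) ^+ 2 <= x * (x + 3) by nra.
have H2 : (x + 1) ^+ 4 <= x ^+ 3 * (x + 15).
  rewrite (_ : (x + 1) ^+ 4 = ((x + 1) ^+ 2) ^+ 2); last by ring.
  apply: (@le_trans _ _ ((x * (x + 3)) ^+ 2)).
    by rewrite lerXn2r ?nnegrE ?sqr_ge0 // mulr_ge0 //; lra.
  rewrite (_ : (x * (x + 3)) ^+ 2 = x ^+ 2 * (x + 3) ^+ 2); last by ring.
  rewrite (_ : x ^+ 3 * (x + 15) = x ^+ 2 * (x * (x + 15))); last by ring.
  by apply: ler_wpM2l; [rewrite sqr_ge0|nra].
rewrite (_ : (x + 1) ^+ 8 = ((x + 1) ^+ 4) ^+ 2); last by ring.
apply: (@le_trans _ _ ((x ^+ 3 * (x + 15)) ^+ 2)).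
  rewrite lerXn2r ?nnegrE ?exprn_ge0 //; first by lra.
  by rewrite mulr_ge0 ?exprn_ge0 //; lra.
rewrite (_ : (x ^+ 3 * (x + 15)) ^+ 2 = x ^+ 6 * (x + 15) ^+ 2); last by ring.
rewrite (_ : _ + _ = x ^+ 6 * (x * (x + 255))); last by ring.
by apply: ler_wpM2l; [rewrite exprn_ge0|nra].
Qed.

Lemma exp8_bracket (n : nat) : exists k, (k ^ 8 <= n < k.+1 ^ 8)%N.
Proof.
elim: n => [|n [k /andP[kn nk]]]; first by exists 0%N.
have [le|gt] := leqP (k.+1 ^ 8) n.+1; last by exists k; rewrite gt (leq_trans kn).
by exists k.+1; rewrite le /= (leq_ltn_trans nk) // ltn_exp2r.
Qed.

(** Between [k^8] and [(k+1)^8] there are at most [255 k^7] further terms, each differing from [L]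
    by at most [1 + |L|], which is negligible against [k^8]. *)
Lemma average_cvg_exp8 (X : nat -> R) (L : R) : (forall i, 0 <= X i <= 1) ->
  (forall e, 0 < e -> exists K : nat, forall k, (K <= k)%N ->
     `|\sum_(1 <= i < (k ^ 8).+1) X i - (k ^ 8)%:R * L| <= e * (k ^ 8)%:R) ->
  (fun n => n%:R^-1 * \sum_(1 <= i < n.+1) X i) @ \oo --> L.
Proof.
move=> X01 H; apply/cvgrPdist_le => e e0.
have e2 : 0 < e / 2 by rewrite divr_gt0.
have [K HK] := H _ e2.
set C := 1 + `|L|; have C0 : 0 < C by rewrite ltr_pwDl.
pose K1 := (Num.trunc (255 * C / (e / 2))).+1.
have K1P : 255 * C / (e / 2) <= K1%:R.
  by rewrite ltW // /K1 truncnS_gt.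
pose K2 := maxn K K1; exists (K2 ^ 8)%N => // n /= nK2.
have [k /andP[kn nk]] := exp8_bracket n.
have K2k : (K2 <= k)%N by rewrite -ltnS -(@ltn_exp2r _ _ 8) // (leq_ltn_trans nK2).
have Kk : (K <= k)%N by apply: leq_trans K2k; rewrite leq_maxl.
have K1k : (K1 <= k)%N by apply: leq_trans K2k; rewrite leq_maxr.
have k0 : (0 < k)%N by apply: leq_trans K1k.
have n0 : (0 < n)%N by apply: leq_trans kn; rewrite expn_gt0 k0.
have nR : 0 < n%:R :> R by rewrite ltr0n.
have kR : 1 <= k%:R :> R by rewrite ler1n.
set S := \sum_(1 <= i < n.+1) X i.
suff HS : `|S - n%:R * L| <= e * n%:R.
  rewrite (_ : L - _ = - (n%:R^-1 * (S - n%:R * L))); last by field; rewrite gt_eqF.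
  rewrite normrN normrM gtr0_norm ?invr_gt0 // mulrC ler_pdivrMr //.
have -> : S - n%:R * L = (\sum_(1 <= i < (k ^ 8).+1) X i - (k ^ 8)%:R * L) +
    \sum_((k ^ 8).+1 <= i < n.+1) (X i - L).
  rewrite /S (@big_cat_nat _ _ _ (k ^ 8).+1) //= sumrB sumr_const_nat subSS.
  have -> : n%:R = (k ^ 8)%:R + (n - k ^ 8)%:R :> R by rewrite -natrD subnKC.
  by rewrite -mulr_natl; ring.
apply: (le_trans (ler_normD _ _)).
have B2 : `|\sum_((k ^ 8).+1 <= i < n.+1) (X i - L)| <= C * (n%:R - (k ^ 8)%:R).
  apply: (le_trans (ler_norm_sum _ _ _)).
  apply: (@le_trans _ _ (\sum_((k ^ 8).+1 <= i < n.+1) C)).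
    apply: ler_sum => i _; rewrite (le_trans (ler_normB _ _)) // lerD2r.
    by have /andP[x0 x1] := X01 i; rewrite ger0_norm.
  by rewrite sumr_const_nat subSS -[leLHS]mulr_natr natrB.
have B3 : n%:R - (k ^ 8)%:R <= 255 * k%:R ^+ 7 :> R.
  have : n%:R <= (k.+1 ^ 8)%:R :> R by rewrite ler_nat ltnW.
  rewrite !natrX -natr1; have := succ_exp8_le kR; lra.
have B4 : C * (255 * k%:R ^+ 7) <= e / 2 * (k ^ 8)%:R.
  rewrite natrX (exprS _ 7) mulrA mulrA ler_wpM2r ?exprn_ge0 ?ler0n //.
  have : 255 * C / (e / 2) <= k%:R by apply: (le_trans K1P); rewrite ler_nat.
  by rewrite ler_pdivrMr //; lra.
have kn' : (k ^ 8)%:R <= n%:R :> R by rewrite ler_nat.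
apply: (@le_trans _ _ (e / 2 * (k ^ 8)%:R + e / 2 * (k ^ 8)%:R)); last by nra.
apply: lerD; first exact: HK.
by apply: (le_trans B2); apply: le_trans B4; rewrite ler_pM2l.
Qed.

(** Since [J < 2^b <= p^b], all factors lie in [[0, 1]], so the partial products decrease and are
    bounded below by 0. *)
Lemma prime_partial_prod_cvg (J b : nat) : (J < 2 ^ b)%N ->
  cvgn (fun N => prime_partial_prod R J b N).
Proof.
move=> J2; set u := fun N => _.
have f01 (p : nat) : prime p -> 0 <= (1 - J%:R / p%:R ^+ b : R) <= 1.
  move=> p_pr; have pb : 0 < p%:R ^+ b :> R by rewrite exprn_gt0 // ltr0n prime_gt0.
  rewrite subr_ge0 gerBl divr_ge0 ?ler0n ?exprn_ge0 ?ler0n // andbT ler_pdivrMr // mul1r.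
  rewrite -natrX ler_nat ltnW // (leq_trans J2) //.
  by case: (b) => // b'; rewrite leq_exp2r // prime_gt1.
have u0 N : 0 <= u N by apply: prodr_ge0 => p /f01 /andP[].
apply: nonincreasing_is_cvgn; last by exists 0 => _ [N _ <-].
apply/nonincreasing_seqP => N; rewrite /u /prime_partial_prod.
rewrite big_mkcond big_ord_recr /= -big_mkcond /=.
by case: ifP => [/f01 /andP[f0 f1]|_]; [rewrite ler_piMr // (u0 N)|rewrite mulr1].
Qed.
End Averages.

(** * Almost sure convergence *)

Section AlmostSure.
Variables (b1 b2 : nat) (W : seq pt).
Variables (d : measure_display) (T : measurableType d) (R : realType).
Variables (P : probability T R) (al : R) (E : nat -> set T).
Hypothesis al01 : 0 < al < 1.
Hypotheses (b1_gt0 : (0 < b1)%N) (b2_gt0 : (0 < b2)%N) (b_coprime : coprime b1 b2).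
Hypotheses (W_uniq : uniq W) (W_star : condition_star b1 b2 W).
Hypotheses (E_meas : forall i, measurable (E i)) (E_prob : forall i, P (E i) = al%:E).
Hypothesis E_indep : mutually_independent P E.

Definition visR (y : pt) : R := (visible_from_all b1 b2 W y)%:R.

Lemma visR01 y : 0 <= visR y <= 1.
Proof. by rewrite /visR ler0n lern1; case: visible_from_all. Qed.

(** The threshold [k^7] is negligible against [k^8], yet Chebyshev's bound
    [k^4 (k^4)^2 / k^14 = k^-2] is summable. *)
Definition large_dev (k : nat) (s : seq bool) : bool :=
  k%:R ^+ 7 < `|block_mart al visR (k ^ 4) (k ^ 4) s|.

Lemma large_dev_ae :
  {ae P, forall w, \forall k \near \oo,
     ~ large_dev k.+1 (step_word E (k.+1 ^ 4 * k.+1 ^ 4) w)}.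
Proof.
apply: (borel_cantelli_sqr (F := fun k => [set w | large_dev k.+1 (step_word E (k.+1 ^ 4 * k.+1 ^ 4) w)])).
  by move=> k; exact: (measurable_step_word E_meas _ (large_dev k.+1)).
move=> k; rewrite (prob_step_word E_meas E_prob E_indep) lee_fin.
have kR : 0 < k.+1%:R :> R by rewrite ltr0n.
have k7 : 0 < k.+1%:R ^+ 7 :> R by rewrite exprn_gt0.
apply: (le_trans (block_mart_deviation al01 (k.+1 ^ 4) visR01 (k.+1 ^ 4) k7)).
rewrite natrX le_eqVlt; apply/orP; left; apply/eqP; field.
by rewrite lt0r_neq0.
Qed.

(** The natural subtraction in [walk_pos] is never truncated, as at most [n] steps are
    horizontal. *)
Lemma walk_pos_sum n (w : T) : (walk_pos E n w).1 + (walk_pos E n w).2 = n%:Z.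
Proof.
rewrite /walk_pos /= -PoszD subnKC //.
apply: (@leq_trans (\sum_(i < n) 1)%N); last by rewrite sum1_card card_ord.
by apply: leq_sum => i _; case: asboolP.
Qed.

(** The deterministic part. The error [e] is split into [e / 4] for truncating the Euler product,
    [e / 4] for the large primes, and [e / 2] for the martingale and the terms [D k^3] of the [k^4]
    blocks, together [(1 + D) k^7]. *)
Lemma visible_sum_exp8 (w : T) (L : R) :
  (fun N => prime_partial_prod R (size W) (b1 + b2) N) @ \oo --> L ->
  (\forall k \near \oo, ~ large_dev k.+1 (step_word E (k.+1 ^ 4 * k.+1 ^ 4) w)) ->
  forall e, 0 < e -> exists K : nat, forall k, (K <= k)%N ->
     `|\sum_(1 <= i < (k ^ 8).+1) visR (walk_pos E i w) - (k ^ 8)%:R * L| <= e * (k ^ 8)%:R.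
Proof.
move=> LP [k0 _ Hk0] e e0.
have e4 : 0 < e / 4 by rewrite divr_gt0.
set J : R := (size W)%:R; have J0 : 0 <= J by rewrite ler0n.
have [M0 _ HM0] : \forall M \near \oo, `|L - prime_partial_prod R (size W) (b1 + b2) M| <= e / 4.
  by move/cvgrPdist_le: LP; apply.
(* The cutoff makes both the truncation error and [4 J / M] at most [e / 4]. It is fixed before [k],
   so [D] is a constant. *)
pose M := maxn M0 (Num.trunc (4 * J / (e / 4))).+1.
have M_gt0 : (0 < M)%N by rewrite leq_max orbT.
have MR : 0 < M%:R :> R by rewrite ltr0n.
have HM : `|L - prime_partial_prod R (size W) (b1 + b2) M| <= e / 4.
  by apply: HM0; rewrite /= leq_maxl.
have HJ : 4 * J / M%:R <= e / 4.
  rewrite ler_pdivrMr // [leRHS]mulrC -ler_pdivrMr // ltW //.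
  by apply: (lt_le_trans (truncnS_gt _)); rewrite ler_nat leq_maxr.
have [D D0 HD] := walk_op_visible_density al01 b1_gt0 b2_gt0 b_coprime W_uniq W_star M_gt0.
pose K1 := (Num.trunc ((1 + D) / (e / 2))).+1.
exists (maxn k0.+1 K1) => k; rewrite geq_max => /andP[k0k K1k].
have k_gt0 : (0 < k)%N by apply: leq_trans k0k.
have HK : (1 + D) <= e / 2 * k%:R.
  rewrite [leRHS]mulrC -ler_pdivrMr ?divr_gt0 // ltW //.
  by apply: (lt_le_trans (truncnS_gt _)); rewrite ler_nat.
have /negP : ~ large_dev k (step_word E (k ^ 4 * k ^ 4) w).
  by have := Hk0 k.-1; rewrite /= prednK //; apply; rewrite -ltnS prednK.
rewrite /large_dev -leNgt; set h := (k ^ 4)%N => HB.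
have hE : (k ^ 8 = h * h)%N by rewrite /h -expnD.
(* The conditional mean of the count in block [j]; subtracting it from the count leaves a martingale
   increment. *)
pose A j := \sum_(m < h) iter m.+1 (walk_op al) visR (walk_pos E (j * h) w).
have -> : \sum_(1 <= i < (k ^ 8).+1) visR (walk_pos E i w) - (k ^ 8)%:R * L =
    block_mart al visR h h (step_word E (h * h) w) + \sum_(j < h) (A j - h%:R * L).
  rewrite hE sum_nat_blocks /block_mart /block_dev -big_split /= natrM -mulrA.
  rewrite mulr_natl -[X in _ *+ X](card_ord h) -sumr_const -sumrB.
  apply: eq_bigr => j _; rewrite addrA; congr (_ - _); rewrite /A -big_split /=.
  apply: eq_bigr => m _.
  have le1 : (j * h + m.+1 <= h * h)%N.
    apply: (@leq_trans (j.+1 * h)); last by rewrite leq_mul2r ltn_ord orbT.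
    by rewrite mulSn addnC leq_add2r ltn_ord.
  by rewrite !pos_at_step_word ?(leq_trans _ le1) ?leq_addr // subrK.
apply: (le_trans (ler_normD _ _)).
have hR : h%:R = k%:R ^+ 4 :> R by rewrite natrX.
have HA (j : 'I_h) : `|A j - h%:R * L| <= (e / 4 + e / 4) * h%:R + D * k%:R ^+ 3.
  have jk : (j * h <= k ^ 8)%N by rewrite hE leq_mul2r ltnW ?orbT.
  have := HD k (j * h)%N _ k_gt0 jk (walk_pos_sum (j * h) w); rewrite -/h -/(A j) -/J => HAj.
  set LM := prime_partial_prod _ _ _ M in HM HAj.
  rewrite (_ : A j - _ = (A j - h%:R * LM) - h%:R * (L - LM)); last by ring.
  apply: (le_trans (ler_normB _ _)); rewrite normrM (ger0_norm (ler0n _ _)).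
  have X1 : h%:R * `|L - LM| <= h%:R * (e / 4) by rewrite ler_wpM2l.
  have X2 : J * (4 * h%:R / M%:R) <= h%:R * (e / 4).
    by rewrite (_ : J * _ = h%:R * (4 * J / M%:R)); [rewrite ler_wpM2l|ring].
  apply: (le_trans (lerD HAj X1)); lra.
have HS : `|\sum_(j < h) (A j - h%:R * L)| <= h%:R * ((e / 4 + e / 4) * h%:R + D * k%:R ^+ 3).
  apply: (le_trans (ler_norm_sum _ _ _)).
  apply: (@le_trans _ _ (\sum_(j < h) ((e / 4 + e / 4) * h%:R + D * k%:R ^+ 3))).
    by apply: ler_sum => j _.
  by rewrite sumr_const card_ord mulr_natl.
apply: (le_trans (lerD HB HS)); rewrite natrX hR.
have k7 : 0 <= k%:R ^+ 7 :> R by rewrite exprn_ge0.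
have := ler_wpM2r k7 HK; set x := k%:R; move=> Hx.
rewrite (_ : e * x ^+ 8 = e / 2 * x * x ^+ 7 + (e / 4 + e / 4) * (x ^+ 4 * x ^+ 4)); last by field.
rewrite (_ : _ + x ^+ 4 * _ = (1 + D) * x ^+ 7 + (e / 4 + e / 4) * (x ^+ 4 * x ^+ 4)); last by ring.
by rewrite lerD2r.
Qed.
End AlmostSure.

Theorem theorem1p1 (b1 b2 : nat) (W : seq pt)
  (d : measure_display) (T : measurableType d) (R : realType)
  (P : probability T R) (alpha : R) (E : nat -> set T) :
  (0 < b1)%N -> (0 < b2)%N -> coprime b1 b2 ->
  0 < alpha < 1 ->
  uniq W -> condition_star b1 b2 W ->
  (size W < 2 ^ (b1 + b2))%N ->
  (forall i, measurable (E i)) ->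
  (forall i, P (E i) = alpha%:E) ->
  mutually_independent P E ->
  exists L : R,
    (fun N => prime_partial_prod R (size W) (b1 + b2) N) @ \oo --> L /\
    {ae P, forall w, (fun n => Sbar R b1 b2 W E n w) @ \oo --> L}.
Proof.
move=> b1_gt0 b2_gt0 b_cop al01 W_uniq W_star W_size E_meas E_prob E_indep.
have L_cvg := prime_partial_prod_cvg (R := R) W_size.
exists (limn (fun N => prime_partial_prod R (size W) (b1 + b2) N)); split; first exact: L_cvg.
(* Probability enters only here: the convergence is deterministic along every path with finitely
   many large deviations. *)
apply: filterS (large_dev_ae b1 b2 W al01 E_meas E_prob E_indep) => w dev.
apply: (@average_cvg_exp8 R (fun i => visR b1 b2 W R (walk_pos E i w))).
  by move=> i; exact: visR01.
exact: (visible_sum_exp8 al01 b1_gt0 b2_gt0 b_cop W_uniq W_star L_cvg dev).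
Qed.
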